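(* Let $B_j$, $j\in\mathbb N$, be zero-mean random processes on $[0,1]$ whose covariance functions are the Korobov kernels $\mathcal K_{\alpha_j,\beta_j,\sigma_j}$ with $\alpha_j>0$, $\beta_j>0$, $\sigma_j>1$, and let $\mathbb B_d$, $d\in\mathbb N$, be the associated additive random fields with average case approximation complexity $n^{\mathbb B_d}(\varepsilon)$. Suppose that, as $j\to\infty$, $$\beta_j\sim c\,j^{-1},\qquad \alpha_j/\beta_j\to r,\qquad \sigma_j\to\infty,$$ with $c>0$ and $0\leqslant r<\infty$. Let $\varepsilon_0=(1+r/2)^{-1/2}$. Then $$\ln n^{\mathbb B_d}(\varepsilon)=\bigl(1-(\varepsilon/\varepsilon_0)^2\bigr)\cdot\ln d+o(\ln d),\qquad d\to\infty,\qquad\text{for every } \varepsilon\in(0,\varepsilon_0).$$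
   Context: $\mathbb N=\{1,2,\dots\}$; $a_j\sim b_j$ means $a_j/b_j\to1$. For $\alpha>0$, $\beta>0$, $\sigma>1$ the Korobov kernel is $\mathcal K_{\alpha,\beta,\sigma}(t,s)=\alpha+2\beta\sum_{k=1}^\infty k^{-\sigma}\cos(2\pi k(t-s))$, $t,s\in[0,1]$. For each $d\in\mathbb N$, $\mathbb B_d(t)$, $t\in[0,1]^d$, is a zero-mean random field (a random element of $L_2([0,1]^d)$) with covariance function $\mathcal K^{\mathbb B_d}(t,s)=\sum_{j=1}^d\mathcal K_{\alpha_j,\beta_j,\sigma_j}(t_j,s_j)$, where $t=(t_1,\dots,t_d)$, $s=(s_1,\dots,s_d)$. Approximation complexity. Let $(\cdot,\cdot)_{2,d}$, $\|\cdot\|_{2,d}$ be the inner product and norm of $L_2([0,1]^d)$. For $n\in\mathbb N$ let $\mathcal A_n^{\mathbb B_d}=\{\sum_{m=1}^n(\mathbb B_d,\psi_m)_{2,d}\,\psi_m:\ \psi_m\in L_2([0,1]^d)\}$ and $e^{\mathbb B_d}(n)=\inf\{(\mathbb E\|\mathbb B_d-\widetilde Y\|_{2,d}^2)^{1/2}:\ \widetilde Y\in\mathcal A_n^{\mathbb B_d}\}$; let $e^{\mathbb B_d}(0)=(\mathbb E\|\mathbb B_d\|_{2,d}^2)^{1/2}$. For $\varepsilon\in(0,1)$, $n^{\mathbb B_d}(\varepsilon)=\min\{n\in\mathbb N:\ e^{\mathbb B_d}(n)\leqslant\varepsilon\,e^{\mathbb B_d}(0)\}$. *)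

(* Defs.v *)
From HB Require Import structures.
From mathcomp Require Import all_boot all_order all_algebra.
From mathcomp Require Import all_classical all_reals all_analysis.

Set Implicit Arguments.
Unset Strict Implicit.
Unset Printing Implicit Defensive.

Import Order.TTheory GRing.Theory Num.Theory.
Import numFieldNormedType.Exports.

Local Open Scope classical_set_scope.
Local Open Scope ring_scope.

Section Cube.
Context {R : realType}.

Definition unit_cube (d : nat) : set (d.-tuple R) :=
  [set t | forall i : 'I_d, 0 <= tnth t i <= 1].

(* [measurableTypeR R] is the copy of [R] on which [uniform_prob] lives. *)
Definition cube_cons (d : nat) (x : measurableTypeR R * d.-tuple R) :
    d.+1.-tuple R :=
  [tuple of (x.1 : R) :: x.2].

Lemma measurable_cube_cons d :
  measurable_fun [set: measurableTypeR R * d.-tuple R] (@cube_cons d).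
Proof.
apply: (@measurable_cons _ _ _ R (fun x => x.1 : R) d (fun x => x.2)).
- exact: measurable_fst.
- exact: measurable_snd.
Qed.

HB.instance Definition _ d := isMeasurableFun.Build _ _ _ _ (@cube_cons d)
  (@measurable_cube_cons d).

(* Lebesgue measure of [0,1]^d, carried by R^d: the d-fold product of the
   uniform law on [0,1], whose density is the indicator of [0,1]. *)
Fixpoint cube_measure (d : nat) : probability (d.-tuple R) R :=
  match d with
  | 0 => dirac ([tuple] : 0.-tuple R)
  | d'.+1 => distribution (uniform_prob (@ltr01 R) \x cube_measure d')%E
               (@cube_cons d')
  end.

End Cube.

Section Kernels.
Context {R : realType}.

Definition korobov (alpha beta sigma : R) (t s : R) : R :=
  alpha + 2 * beta *
    limn (fun n => \sum_(1 <= k < n)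
                     k%:R `^ (- sigma) * cos (2 * pi * k%:R * (t - s))).

(* The sequences of parameters are indexed by j = 1, 2, ...; coordinate
   [i : 'I_d] of a point of the cube carries the parameters of index i + 1. *)
Definition additive_korobov (alpha beta sigma : nat -> R) (d : nat)
    (t s : d.-tuple R) : R :=
  \sum_(i < d) korobov (alpha i.+1) (beta i.+1) (sigma i.+1)
                       (tnth t i) (tnth s i).

End Kernels.

Section RandomFields.
Context {R : realType} {dO : measure_display} {Omega : measurableType dO}.
Variables (P : probability Omega R) (d : nat).
Implicit Types (B Y : Omega -> d.-tuple R -> R).

(* A field on [0,1]^d is a jointly measurable function on Omega x R^d of which
   only the values over [0,1]^d matter (extend by 0, say).  When the kernel [K]
   is bounded on the cube, Tonelli gives E ||B||^2 < +oo, so almost all paths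
   are in L_2([0,1]^d). *)
Record centered_field (K : d.-tuple R -> d.-tuple R -> R) B : Prop := {
  field_measurable :
    measurable_fun [set: Omega * d.-tuple R] (fun x => B x.1 x.2) ;
  field_L2 : forall t, unit_cube t -> B^~ t \in Lfun P 2%:E ;
  field_mean : forall t, unit_cube t -> ('E_P[B^~ t] = 0)%E ;
  field_cov : forall t s, unit_cube t -> unit_cube s ->
    covariance P (B^~ t) (B^~ s) = (K t s)%:E }.

Definition inner2 (f g : d.-tuple R -> R) : R :=
  \int[cube_measure d]_t (f t * g t).

Definition approximant (n : nat) B (psi : 'I_n -> d.-tuple R -> R) :
    Omega -> d.-tuple R -> R :=
  fun w t => \sum_(m < n) inner2 (B w) (psi m) * psi m t.

Definition rms_norm Y : \bar R :=
  ((\int[P]_w ('N[cube_measure d]_2%:E[EFin \o Y w] ^+ 2)) `^ 2^-1)%E.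

Definition approx_error B (n : nat) : \bar R :=
  if n is 0 then rms_norm B else
  ereal_inf [set rms_norm (fun w t => B w t - approximant B psi w t) |
    psi in [set psi : 'I_n -> d.-tuple R -> R |
            forall m, psi m \in Lfun (cube_measure d) 2%:E]].

Definition admissible B (eps : R) : set nat :=
  [set n | (0 < n)%N /\ (approx_error B n <= eps%:E * approx_error B 0)%E].

(* The least admissible [n] (the default 0 is returned only when there is
   none). *)
Definition complexity B (eps : R) : nat :=
  xget 0%N [set n | admissible B eps n /\
                    forall m, admissible B eps m -> (n <= m)%N].

End RandomFields.

(* Main.v *)
Require Import Defs.
From HB Require Import structures.
From mathcomp Require Import all_boot all_order all_algebra.
From mathcomp Require Import all_classical all_reals all_analysis.
From mathcomp Require Import measurable_realfun ring lra zify.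

Set Implicit Arguments.
Unset Strict Implicit.
Unset Printing Implicit Defensive.

Import Order.TTheory GRing.Theory Num.Theory.
Import numFieldNormedType.Exports.

Local Open Scope classical_set_scope.
Local Open Scope ring_scope.

(** The covariance operator of the field has an explicit orthonormal system of
    eigenfunctions: the constant 1, with eigenvalue [alpha_1 + ... + alpha_d],
    and for each coordinate j the waves [sqrt 2 cos (2 pi k t_j)] and
    [sqrt 2 sin (2 pi k t_j)], with eigenvalue [beta_j k^(-sigma_j)].  As
    [sigma_j] tends to infinity the frequencies [k >= 2] carry a negligible part
    of the trace, so only the constant and the waves of frequency 1 matter.
    With [beta_j ~ c / j] the trace is [(r + 2) c ln d + o(ln d)]; the constant
    takes [r c ln d] of it, and the two waves in each of the first m coordinates
    take [2 c ln m].  An approximation by these [2 m + 1] functions therefore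
    has squared error [2 c (ln d - ln m) + o(ln d)], and equating it with
    [eps^2 (r + 2) c ln d] gives
    [ln m = (1 - eps^2 (1 + r / 2)) ln d], where [1 + r / 2 = eps0^(-2)].

    Upper bound on the complexity.  Projecting on orthonormal eigenfunctions
    leaves the trace minus the eigenvalues used ([mean_sq_error_eigen],
    [admissible_truncation]).

    Lower bound.  The functions [psi_m] of an approximant are arbitrary, so the
    optimality of eigenfunctions has to be proved.  Rather than the spectral
    theory of compact operators, a finite-dimensional argument is used.  By
    Bessel's inequality the squared error is at least that of the coefficients
    on the chosen orthonormal eigenfunctions.  On these, the approximant takes
    values in the row space of the Gram matrix [<psi_m, phi_i>], whose rank is
    at most n; if p is the orthogonal projector on that space, the expected
    squared distance is at least [\sum_i (1 - p_ii) lambda_i], where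
    [0 <= p_ii <= 1] and the trace of p is at most n ([mean_sq_error_ge]).  The
    waves alone are kept here, and [\sum_i p_ii lambda_i] exceeds
    [2 (beta_1 + ... + beta_n)] by a bounded amount at most, because [j beta_j]
    is bounded ([sum_weights_le], [admissible_lower_bound]).

    The Fubini theorem turns covariances of coefficients into eigenvalues
    ([coef_cov]), and integrals of characters [cos (2 pi <m, t> + a)] over the
    cube verify the eigenfunction equations ([integral_character],
    [eigen_wave]).  The passage to logarithms rests on the comparison of
    [a_1 + ... + a_m] with [k ln m] when [j a_j] tends to k
    ([log_asymptotic_sum]). *)

(** * Orthogonal projectors on row spaces *)

Section OrthogonalProjector.
Variable R : realFieldType.

Lemma mulmx_trE m (v : 'rV[R]_m) : (v *m v^T) 0 0 = \sum_i v 0 i ^+ 2.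
Proof. by rewrite mxE; apply: eq_bigr => i _; rewrite mxE. Qed.

Lemma mulmx_tr_eq0 m (v : 'rV[R]_m) : v *m v^T = 0 -> v = 0.
Proof.
move=> v0; apply/rowP => i; rewrite mxE.
have /psumr_eq0P : \sum_i v 0 i ^+ 2 = 0 by rewrite -mulmx_trE v0 mxE.
move/(_ (fun i _ => sqr_ge0 _) i isT)/eqP; rewrite sqrf_eq0 => /eqP//.
Qed.

(** Over an ordered field [v C C^T = 0] forces [|v C|^2 = 0]. *)
Lemma gram_unit m n (C : 'M[R]_(m, n)) : row_free C -> C *m C^T \in unitmx.
Proof.
move=> Cfree; rewrite -row_free_unit; apply/row_freeP.
have kS0 : kermx (C *m C^T) = 0.
  apply/row_matrixP => i; rewrite row0; set v := row i _.
  have vS : v *m (C *m C^T) = 0 by rewrite /v -row_mul mulmx_ker row0.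
  have vC : v *m C = 0.
    apply: mulmx_tr_eq0; rewrite trmx_mul.
    by rewrite [LHS]mulmxA -[v *m C *m _]mulmxA vS mul0mx.
  by apply/(row_free_inj Cfree); rewrite vC mul0mx.
by apply/row_freeP; rewrite -kermx_eq0 kS0.
Qed.

(** With C a basis of the row space of G, the projector is
    [C^T (C C^T)^-1 C]; its trace is the rank of G. *)
Lemma ex_orthogonal_projector n N (G : 'M[R]_(n, N)) :
  exists p : 'M[R]_N, [/\ p^T = p, p *m p = p, G *m p = G & \tr p <= n%:R].
Proof.
have [C Su GC] : exists2 C : 'M[R]_(\rank G, N),
    C *m C^T \in unitmx & (G <= C)%MS.
  by exists (row_base G); [exact/gram_unit/row_base_free | rewrite eq_row_base].
exists (C^T *m invmx (C *m C^T) *m C); split.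
- by rewrite !trmx_mul trmxK trmx_inv trmx_mul trmxK mulmxA.
- by rewrite !mulmxA -[_ *m C *m C^T]mulmxA mulmxKV.
- have /submxP[D GE] := GC.
  by rewrite {1}GE -!mulmxA (mulmxA C) (mulmxA (C *m C^T)) mulmxV// mul1mx -GE.
- rewrite -mulmxA mxtrace_mulC -mulmxA mulVmx// mxtrace1 ler_nat.
  exact: rank_leq_row.
Qed.

(** Symmetry and idempotence give [p_ii = \sum_j p_ij^2 >= p_ii^2]. *)
Lemma projector_diag N (p : 'M[R]_N) (i : 'I_N) : p^T = p -> p *m p = p ->
  0 <= p i i <= 1.
Proof.
move=> pT pp.
have pii : p i i = \sum_j p i j ^+ 2.
  rewrite -{1}pp mxE; apply: eq_bigr => j _.
  by rewrite -{2}pT mxE.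
have p0 : 0 <= p i i by rewrite pii sumr_ge0// => j _; rewrite sqr_ge0.
rewrite p0 /= leNgt; apply/negP => p1.
have : p i i ^+ 2 <= p i i.
  by rewrite {2}pii (bigD1 i)//= lerDl sumr_ge0// => j _; rewrite sqr_ge0.
by rewrite expr2 ger_pMr ?(lt_trans ltr01)// leNgt p1.
Qed.

Lemma projector_residual N (p : 'M[R]_N) (u : 'rV[R]_N) : p^T = p -> p *m p = p ->
  (u *m (1%:M - p) *m u^T) 0 0 = \sum_i (u *m (1%:M - p)) 0 i ^+ 2.
Proof.
move=> pT pp; have qT : (1%:M - p)^T = 1%:M - p by rewrite raddfB /= trmx1 pT.
rewrite -mulmx_trE trmx_mul qT mulmxA.
have qq : (1%:M - p) *m (1%:M - p) = 1%:M - p.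
  by rewrite mulmxBl mul1mx mulmxBr mulmx1 pp subrr subr0.
by rewrite -[u *m _ *m (_ - _)]mulmxA qq.
Qed.

(** The vector [z G] lies in the range of p, so [1 - p] kills it, and [1 - p]
    does not increase norms. *)
Lemma projector_residual_le n N (p : 'M[R]_N) (G : 'M[R]_(n, N))
    (x : 'rV[R]_N) (z : 'rV[R]_n) :
  p^T = p -> p *m p = p -> G *m p = G ->
  0 <= (x *m (1%:M - p) *m x^T) 0 0 <= \sum_i (x - z *m G) 0 i ^+ 2.
Proof.
move=> pT pp Gp; rewrite projector_residual//.
apply/andP; split; first by apply: sumr_ge0 => i _; exact: sqr_ge0.
have xG : x *m (1%:M - p) = (x - z *m G) *m (1%:M - p).
  by rewrite [RHS]mulmxBl -(mulmxA z) [G *m _]mulmxBr mulmx1 Gp subrr mulmx0 subr0.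
rewrite xG -projector_residual//; set u := x - _.
have pu : (u *m p *m u^T) 0 0 = \sum_i (u *m p) 0 i ^+ 2.
  by rewrite -mulmx_trE trmx_mul pT !mulmxA -(mulmxA u p p) pp.
rewrite mulmxBr mulmx1 mulmxBl mxE mulmx_trE mxE pu gerBl.
by apply: sumr_ge0 => i _; exact: sqr_ge0.
Qed.
End OrthogonalProjector.

(** * Square-integrable functions *)

Section SquareIntegrable.
Context d (T : measurableType d) (R : realType).
Variable mu : {measure set T -> \bar R}.
Implicit Types f g h : T -> R.

Lemma Lfun2P f : measurable_fun setT f ->
  (\int[mu]_x ((f x ^+ 2)%:E) < +oo)%E -> f \in Lfun mu 2%:E.
Proof.
move=> mf fi; rewrite inE; apply/andP; split; rewrite inE//=.
rewrite /finite_norm unlock /Lnorm poweR_lty//.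
under eq_integral => x _ do
  rewrite /= powR_mulrn ?normr_ge0// -normrX ger0_norm ?sqr_ge0//.
exact: fi.
Qed.

Lemma Lfun2_measurable f : f \in Lfun mu 2%:E -> measurable_fun setT f.
Proof. by rewrite inE => /andP[]; rewrite inE. Qed.

Lemma Lfun2_integrableM f g : f \in Lfun mu 2%:E -> g \in Lfun mu 2%:E ->
  mu.-integrable setT (EFin \o (f \* g)).
Proof. by move=> fL gL; apply/Lfun1_integrable; exact: Lfun2_mul_Lfun1. Qed.

Definition dot f g : R := \int[mu]_x (f x * g x).

Lemma dotC f g : dot f g = dot g f.
Proof. by apply: eq_Rintegral => x _; rewrite mulrC. Qed.

Lemma dot_ge0 f : 0 <= dot f f.
Proof. by apply: Rintegral_ge0 => x _; rewrite -expr2 sqr_ge0. Qed.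

Lemma EFin_dot f g : f \in Lfun mu 2%:E -> g \in Lfun mu 2%:E ->
  (dot f g)%:E = (\int[mu]_x ((f x * g x)%:E))%E.
Proof.
by move=> fL gL; rewrite fineK// integrable_fin_num//; exact: Lfun2_integrableM.
Qed.

Lemma dotDl f g h : f \in Lfun mu 2%:E -> g \in Lfun mu 2%:E ->
  h \in Lfun mu 2%:E -> dot (f + g) h = dot f h + dot g h.
Proof.
move=> fL gL hL; rewrite /dot -RintegralD//; [|exact: Lfun2_integrableM..].
by apply: eq_Rintegral => x _; rewrite -mulrDl.
Qed.

Lemma dotZl (a : R) f h : f \in Lfun mu 2%:E -> h \in Lfun mu 2%:E ->
  dot (a *: f) h = a * dot f h.
Proof.
move=> fL hL; rewrite /dot -RintegralZl//; last exact: Lfun2_integrableM.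
by apply: eq_Rintegral => x _; rewrite mulrA.
Qed.

Lemma Lfun2D f g : f \in Lfun mu 2%:E -> g \in Lfun mu 2%:E ->
  f + g \in Lfun mu 2%:E.
Proof. exact: (Lfun_addr_closed mu (lee1n 2)).2. Qed.

Lemma Lfun2Z (a : R) f : f \in Lfun mu 2%:E -> a *: f \in Lfun mu 2%:E.
Proof.
move=> fL; rewrite (_ : a *: f = a \o* f); first by apply: Lfun_scale; rewrite ?ler1n.
by apply/funext => x; rewrite /= mulrC.
Qed.

Lemma Lfun2_sum (I : Type) (s : seq I) (F : I -> T -> R) :
  (forall i, F i \in Lfun mu 2%:E) -> \sum_(i <- s) F i \in Lfun mu 2%:E.
Proof.
move=> FL; elim: s => [|i s IH]; last by rewrite big_cons Lfun2D.
by rewrite big_nil; exact: (Lfun_addr_closed mu (lee1n 2)).1.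
Qed.

Lemma dot0l h : dot 0 h = 0.
Proof.
rewrite /dot (@eq_Rintegral _ _ _ _ _ (fun=> 0)); last by move=> x _; rewrite mul0r.
by rewrite Rintegral_cst ?mul0r.
Qed.

Lemma dot_suml (I : Type) (s : seq I) (F : I -> T -> R) h :
  (forall i, F i \in Lfun mu 2%:E) -> h \in Lfun mu 2%:E ->
  dot (\sum_(i <- s) F i) h = \sum_(i <- s) dot (F i) h.
Proof.
move=> FL hL; elim: s => [|i s IH]; first by rewrite !big_nil dot0l.
by rewrite !big_cons dotDl ?Lfun2_sum// IH.
Qed.

Lemma dot_sumZl (I : Type) (s : seq I) (a : I -> R) (F : I -> T -> R) h :
  (forall i, F i \in Lfun mu 2%:E) -> h \in Lfun mu 2%:E ->
  dot (\sum_(i <- s) a i *: F i) h = \sum_(i <- s) a i * dot (F i) h.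
Proof.
move=> FL hL; rewrite dot_suml// => [|i]; last exact: Lfun2Z.
by apply: eq_bigr => i _; rewrite dotZl.
Qed.

Lemma dotBl f g h : f \in Lfun mu 2%:E -> g \in Lfun mu 2%:E ->
  h \in Lfun mu 2%:E -> dot (f - g) h = dot f h - dot g h.
Proof.
by move=> fL gL hL; rewrite -scaleN1r dotDl ?Lfun2Z// dotZl// mulN1r.
Qed.

Lemma Lfun2B f g : f \in Lfun mu 2%:E -> g \in Lfun mu 2%:E ->
  f - g \in Lfun mu 2%:E.
Proof. by move=> fL gL; rewrite -scaleN1r Lfun2D ?Lfun2Z. Qed.

Definition orthonormal (I : finType) (phi : I -> T -> R) :=
  (forall i, phi i \in Lfun mu 2%:E) /\
  (forall i j, dot (phi i) (phi j) = (i == j)%:R).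

(** Pythagoras for the orthogonal projection on an orthonormal family. *)
Lemma dot_residual (I : finType) (phi : I -> T -> R) f :
  orthonormal phi -> f \in Lfun mu 2%:E ->
  dot (f - \sum_i dot f (phi i) *: phi i) (f - \sum_i dot f (phi i) *: phi i)
  = dot f f - \sum_i dot f (phi i) ^+ 2.
Proof.
move=> [phiL phiO] fL; set p := \sum_i _.
have pL : p \in Lfun mu 2%:E by apply: Lfun2_sum => i; exact: Lfun2Z.
have pphi i : dot p (phi i) = dot f (phi i).
  rewrite dot_sumZl// (bigD1 i)//= phiO eqxx mulr1 big1 ?addr0// => j ji.
  by rewrite phiO (negbTE ji) mulr0.
have pf : dot p f = \sum_i dot f (phi i) ^+ 2.
  rewrite dot_sumZl//; apply: eq_bigr => i _.
  by rewrite dotC expr2 [dot (phi i) f]dotC.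
have pp : dot p p = \sum_i dot f (phi i) ^+ 2.
  rewrite {1}/p dot_sumZl//; apply: eq_bigr => i _.
  by rewrite [dot (phi i) p]dotC pphi expr2.
rewrite dotBl ?Lfun2B// dotC dotBl// [dot p (f - p)]dotC dotBl//.
by rewrite [dot f p]dotC pf pp subrr subr0.
Qed.

Lemma bessel (I : finType) (phi : I -> T -> R) f :
  orthonormal phi -> f \in Lfun mu 2%:E ->
  \sum_i dot f (phi i) ^+ 2 <= dot f f.
Proof. by move=> phiO fL; rewrite -subr_ge0 -dot_residual// dot_ge0. Qed.

Lemma cauchy_schwarz f g : f \in Lfun mu 2%:E -> g \in Lfun mu 2%:E ->
  dot f g ^+ 2 <= dot f f * dot g g.
Proof.
move=> fL gL.
(* the squared norm of f + a g, for a real parameter a *)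
have key (a : R) : 0 <= dot f f + a * 2 * dot f g + a ^+ 2 * dot g g.
  have := dot_ge0 (f + a *: g).
  rewrite dotDl ?Lfun2D ?Lfun2Z// dotZl ?Lfun2D ?Lfun2Z//.
  rewrite ![dot _ (f + a *: g)]dotC !dotDl ?Lfun2Z// !dotZl// [dot g f]dotC.
  by congr (_ <= _); ring.
have [g0|g0] := eqVneq (dot g g) 0.
  rewrite g0 mulr0; have [->|f0] := eqVneq (dot f g) 0; first by rewrite expr0n.
  (* this value of a would make the quadratic polynomial equal to -1 *)
  have := key (- (dot f f + 1) / (2 * dot f g)).
  rewrite g0 (_ : _ + _ = -1); last by field.
  by rewrite oppr_ge0 ler10.
have gp : 0 < dot g g by rewrite lt_neqAle eq_sym g0 dot_ge0.
have := key (- dot f g / dot g g).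
rewrite (_ : _ + _ = dot f f - dot f g ^+ 2 / dot g g); last by field.
by rewrite subr_ge0 ler_pdivrMr.
Qed.

End SquareIntegrable.

Section Bounded.
Context d (T : measurableType d) (R : realType).
Variable mu : {finite_measure set T -> \bar R}.

Lemma bounded_integrable (f : T -> R) (M : R) : measurable_fun setT f ->
  (forall x, `|f x| <= M) -> mu.-integrable setT (EFin \o f).
Proof.
move=> mf fM.
apply: (@le_integrable _ _ _ _ _ _ _ (EFin \o cst M)) => //.
- exact/measurable_EFinP.
- by move=> x _; rewrite /= lee_fin (le_trans (fM x)) ?ler_norm.
- exact: finite_measure_integrable_cst.
Qed.

Lemma bounded_Lfun2 (f : T -> R) (M : R) : measurable_fun setT f ->
  (forall x, `|f x| <= M) -> f \in Lfun mu 2%:E.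
Proof.
move=> mf fM; apply: Lfun2P => //; apply: integrable_lty => //.
apply: (@bounded_integrable _ (M ^+ 2)); first exact: measurable_funX.
by move=> x; rewrite normrX lerXn2r ?nnegrE// (le_trans _ (fM x)).
Qed.

End Bounded.

(** * Square-integrable functions on a product *)

Section ProductL2.
Context dO (Omega : measurableType dO) dT (T : measurableType dT) (R : realType).
Variables (P : probability Omega R) (mu : probability T R).
Implicit Types F G : Omega * T -> R.

Local Notation L2prod := (Lfun (P \x mu)%E 2%:E).

Lemma Lfun2_tensor (a : Omega -> R) (b : T -> R) :
  a \in Lfun P 2%:E -> b \in Lfun mu 2%:E ->
  (fun z => a z.1 * b z.2) \in L2prod.
Proof.
move=> aL bL; have ma := Lfun2_measurable aL; have mb := Lfun2_measurable bL.
have mab : measurable_fun setT (fun z : Omega * T => a z.1 * b z.2).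
  by apply: measurable_funM; apply: measurableT_comp.
apply: Lfun2P => //.
rewrite fubini_tonelli1; last 2 first.
- by apply/measurable_EFinP; exact: measurable_funX.
- by move=> z; rewrite lee_fin sqr_ge0.
rewrite (eq_integral (fun w => (dot mu b b)%:E * (a w ^+ 2)%:E)%E); last first.
  move=> w _; rewrite /fubini_F EFin_dot//= muleC.
  rewrite -ge0_integralZl//.
  - by apply: eq_integral => t _; rewrite -EFinM exprMn -expr2.
  - by apply/measurable_EFinP; exact: measurable_funM.
  - by move=> t _; rewrite lee_fin -expr2 sqr_ge0.
  - by rewrite lee_fin sqr_ge0.
rewrite ge0_integralZl//; last 3 first.
- by apply/measurable_EFinP; exact: measurable_funX.
- by move=> w _; rewrite lee_fin sqr_ge0.
- by rewrite lee_fin dot_ge0.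
rewrite (eq_integral (fun w => (a w * a w)%:E)); last by move=> w _; rewrite expr2.
by rewrite -EFin_dot// -EFinM ltry.
Qed.

Lemma L2prod_integrableM F G : F \in L2prod -> G \in L2prod ->
  (P \x mu)%E.-integrable setT (EFin \o (F \* G)).
Proof. exact: Lfun2_integrableM. Qed.

(** The product of two square-integrable functions is integrable, which is all
    that Fubini's theorem asks for. *)
Lemma L2prod_fubini F G : F \in L2prod -> G \in L2prod ->
  (\int[P]_w \int[mu]_t (F (w, t) * G (w, t))%:E =
   \int[mu]_t \int[P]_w (F (w, t) * G (w, t))%:E)%E.
Proof. by move=> FL GL; exact: (Fubini (L2prod_integrableM FL GL)). Qed.

Lemma L2prod_ae1 F : F \in L2prod ->
  {ae P, forall w, (fun t => F (w, t)) \in Lfun mu 2%:E}.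
Proof.
move=> FL; have := ae_integrable1 (Lfun2_integrable_sqr FL).
apply: filterS => w /integrableP[_ Fw].
have mF := Lfun2_measurable FL.
apply: Lfun2P; first by apply: (measurableT_comp mF); exact: pair1_measurable.
apply: le_lt_trans Fw; rewrite le_eqVlt; apply/orP; left; apply/eqP.
by apply: eq_integral => t _; rewrite /= ger0_norm ?sqr_ge0.
Qed.

End ProductL2.

(** * Coefficients of a second-order random field *)

Section SecondOrderField.
Context dO (Omega : measurableType dO) dT (T : measurableType dT) (R : realType).
Variables (P : probability Omega R) (mu : probability T R).
Variables (X : Omega -> T -> R) (U : set T) (K : T -> T -> R) (kappa : R).
Implicit Types (phi psi : T -> R).

(** Covariances are prescribed on a set U of full measure only, as for a field
    on the cube carried by the whole space.  The diagonal of the kernel is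
    constant, as it is for a stationary field; this constant is the trace of the
    covariance operator. *)
Record second_order_field : Prop := SecondOrderField {
  sof_measurable : measurable_fun setT (fun z : Omega * T => X z.1 z.2) ;
  sof_full : {ae mu, forall t, U t} ;
  sof_L2 : forall t, U t -> X^~ t \in Lfun P 2%:E ;
  sof_cov : forall t s, U t -> U s -> dot P (X^~ t) (X^~ s) = K t s ;
  sof_kernel_measurable : forall t, U t -> measurable_fun setT (K t) ;
  sof_trace : forall t, U t -> K t t = kappa }.

Hypothesis XP : second_order_field.

Let XX (z : Omega * T) := X z.1 z.2.

Let cst1L2 : (cst 1 : Omega -> R) \in Lfun P 2%:E.
Proof. exact: Lfun_cst. Qed.

Let mXX2 : measurable_fun setT (fun z => (XX z ^+ 2)%:E).
Proof. by apply/measurable_EFinP; apply: measurable_funX; exact: sof_measurable XP. Qed.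

Lemma second_moment : (\int[P]_w \int[mu]_t (X w t ^+ 2)%:E = kappa%:E)%E.
Proof.
rewrite (fubini_tonelli (fun z => (XX z ^+ 2)%:E))//; last first.
  by move=> z; rewrite lee_fin sqr_ge0.
rewrite -[RHS]mule1 -(@probability_setT _ _ _ mu) -integral_cst//.
apply: ae_eq_integral => //.
- apply: (measurable_fun_fubini_tonelli_G (fun z => (XX z ^+ 2)%:E)) => //.
  by move=> z; rewrite lee_fin sqr_ge0.
- apply: filterS (sof_full XP) => t Ut _ /=.
  rewrite -(sof_trace XP Ut) -(sof_cov XP Ut Ut) EFin_dot//; try exact: sof_L2.
Qed.

Let XXL2 : XX \in Lfun (P \x mu)%E 2%:E.
Proof.
apply: Lfun2P; first exact: sof_measurable XP.
rewrite fubini_tonelli1//; last by move=> z; rewrite lee_fin sqr_ge0.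
by rewrite /fubini_F /XX /= second_moment ltry.
Qed.

Lemma path_L2 : {ae P, forall w, X w \in Lfun mu 2%:E}.
Proof. exact: (L2prod_ae1 XXL2). Qed.

Definition coef phi w := dot mu (X w) phi.

Let integrable_XXM phi : phi \in Lfun mu 2%:E ->
  (P \x mu)%E.-integrable setT (EFin \o (fun z => X z.1 z.2 * phi z.2)).
Proof.
move=> phiL; have := L2prod_integrableM XXL2 (Lfun2_tensor cst1L2 phiL).
by apply: eq_integrable => // z _; rewrite /= mul1r.
Qed.

Lemma measurable_coef phi : phi \in Lfun mu 2%:E ->
  measurable_fun setT (coef phi).
Proof.
move=> phiL; rewrite /coef /dot /Rintegral.
apply: (measurableT_comp (fine_measurable _)) => //.
exact: (measurable_fubini_F (integrable_XXM phiL)).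
Qed.

Lemma measurable_path_norm : measurable_fun setT
  (fun w => (\int[mu]_t (X w t ^+ 2)%:E)%E).
Proof.
apply: (measurable_fun_fubini_tonelli_F (fun z => (XX z ^+ 2)%:E)) => //.
by move=> z; rewrite lee_fin sqr_ge0.
Qed.

(** Cauchy-Schwarz on each path bounds the second moment of a coefficient by
    [kappa |phi|^2]. *)
Lemma coef_L2 phi : phi \in Lfun mu 2%:E -> coef phi \in Lfun P 2%:E.
Proof.
move=> phiL; apply: Lfun2P; first exact: measurable_coef.
apply: (@le_lt_trans _ _ (\int[P]_w ((dot mu phi phi)%:E *
    \int[mu]_t (X w t ^+ 2)%:E))%E).
  apply: ae_ge0_le_integral => //.
  - by move=> w _; rewrite lee_fin sqr_ge0.
  - by apply/measurable_EFinP; apply: measurable_funX; exact: measurable_coef.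
  - move=> w _; rewrite mule_ge0 ?lee_fin ?dot_ge0//.
    by apply: integral_ge0 => t _; rewrite lee_fin sqr_ge0.
  - by apply: emeasurable_funM => //; exact: measurable_path_norm.
  - apply: filterS path_L2 => w XwL _.
    rewrite (eq_integral (fun t => (X w t * X w t)%:E)); last first.
      by move=> t _; rewrite expr2.
    by rewrite -EFin_dot// -EFinM lee_fin mulrC cauchy_schwarz.
rewrite ge0_integralZl//.
- by rewrite second_moment -EFinM ltry.
- exact: measurable_path_norm.
- by move=> w _; apply: integral_ge0 => t _; rewrite lee_fin sqr_ge0.
- by rewrite lee_fin dot_ge0.
Qed.

Definition eigenfunction phi (lambda : R) :=
  phi \in Lfun mu 2%:E /\
  forall t, U t -> (\int[mu]_s (K t s * phi s)%:E = (lambda * phi t)%:E)%E.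

(** Exchanging the expectation with the inner integral produces the covariance
    operator applied to psi. *)
Lemma coef_path_cov psi lambda t : eigenfunction psi lambda -> U t ->
  (\int[P]_w (X w t * coef psi w)%:E = (lambda * psi t)%:E)%E.
Proof.
move=> [psiL psiK] Ut; have XtL := sof_L2 XP Ut.
transitivity (\int[P]_w \int[mu]_s (X w s * (X w t * psi s))%:E)%E.
  apply: ae_eq_integral => //.
  - apply/measurable_EFinP; apply: measurable_funM; first exact: Lfun2_measurable XtL.
    exact: measurable_coef.
  - exact: (measurable_fubini_F (L2prod_integrableM XXL2 (Lfun2_tensor XtL psiL))).
  - apply: filterS path_L2 => w XwL _ /=.
    rewrite EFinM EFin_dot// -integralZl//; last exact: Lfun2_integrableM.
    by apply: eq_integral => s _; rewrite -EFinM mulrCA.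
rewrite (L2prod_fubini XXL2 (Lfun2_tensor XtL psiL))/=.
rewrite -psiK//; apply: ae_eq_integral => //.
- exact: (measurable_fubini_G (L2prod_integrableM XXL2 (Lfun2_tensor XtL psiL))).
- apply/measurable_EFinP; apply: measurable_funM; last exact: Lfun2_measurable psiL.
  exact: sof_kernel_measurable XP _ Ut.
- apply: filterS (sof_full XP) => s Us _ /=.
  have XsL := sof_L2 XP Us.
  rewrite -(sof_cov XP Ut Us) EFinM EFin_dot// -integralZr//; last exact: Lfun2_integrableM.
  by apply: eq_integral => w _; rewrite -EFinM /= ?/XX /=; congr EFin; ring.
Qed.

(** Coefficients on orthogonal eigenfunctions are thus uncorrelated, with the
    eigenvalues as variances.  Fubini's theorem is applied a second time, to the
    outer coefficient, after [coef_path_cov] has dealt with the inner one. *)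
Lemma coef_cov phi psi lambda : phi \in Lfun mu 2%:E -> eigenfunction psi lambda ->
  dot P (coef phi) (coef psi) = lambda * dot mu phi psi.
Proof.
move=> phiL psiE; have [psiL _] := psiE.
have cL := coef_L2 phiL; have dL := coef_L2 psiL.
apply: EFin_inj; rewrite EFin_dot// EFinM EFin_dot// -integralZl//; last first.
  exact: Lfun2_integrableM.
transitivity (\int[P]_w \int[mu]_t (X w t * (coef psi w * phi t))%:E)%E.
  apply: ae_eq_integral => //.
  - by apply/measurable_EFinP; apply: measurable_funM; exact: measurable_coef.
  - exact: (measurable_fubini_F (L2prod_integrableM XXL2 (Lfun2_tensor dL phiL))).
  - apply: filterS path_L2 => w XwL _ /=.
    rewrite EFinM [(coef phi w)%:E]EFin_dot// -integralZr//; last exact: Lfun2_integrableM.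
    by apply: eq_integral => s _; rewrite -EFinM /= ?/XX /=; congr EFin; ring.
rewrite (L2prod_fubini XXL2 (Lfun2_tensor dL phiL))/=.
apply: ae_eq_integral => //.
- exact: (measurable_fubini_G (L2prod_integrableM XXL2 (Lfun2_tensor dL phiL))).
- apply/measurable_EFinP; apply: measurable_funM => //.
  by apply: measurable_funM; [exact: Lfun2_measurable phiL|exact: Lfun2_measurable psiL].
- apply: filterS (sof_full XP) => t Ut _ /=.
  have XtL := sof_L2 XP Ut.
  rewrite (eq_integral (fun w => (phi t)%:E * (X w t * coef psi w)%:E)%E); last first.
    by move=> w _; rewrite -EFinM /= ?/XX /=; congr EFin; ring.
  rewrite integralZl//; last exact: Lfun2_integrableM.
  by rewrite (coef_path_cov psiE Ut) -!EFinM; congr EFin; ring.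
Qed.

End SecondOrderField.

(** * Mean square error of approximations of finite rank *)

Section RankBounds.
Context dO (Omega : measurableType dO) dT (T : measurableType dT) (R : realType).
Variables (P : probability Omega R) (mu : probability T R).
Variables (X : Omega -> T -> R) (U : set T) (K : T -> T -> R) (kappa : R).
Hypothesis XP : second_order_field P mu X U K kappa.

Local Notation coef := (coef mu X).

Definition residual n (psi : 'I_n -> T -> R) w t :=
  X w t - \sum_(m < n) coef (psi m) w * psi m t.

Definition mean_sq_error n (psi : 'I_n -> T -> R) : \bar R :=
  (\int[P]_w \int[mu]_t (residual psi w t ^+ 2)%:E)%E.

Lemma residualE n (psi : 'I_n -> T -> R) w :
  residual psi w = X w - \sum_(m < n) coef (psi m) w *: psi m.
Proof. by apply/funext => t; rewrite /residual !fctE fct_sumE. Qed.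

Lemma residual_L2 n (psi : 'I_n -> T -> R) w :
  (forall m, psi m \in Lfun mu 2%:E) -> X w \in Lfun mu 2%:E ->
  residual psi w \in Lfun mu 2%:E.
Proof.
move=> psiL XwL; rewrite residualE; apply: Lfun2B => //.
by apply: Lfun2_sum => m; exact: Lfun2Z.
Qed.

Lemma integral_residual n (psi : 'I_n -> T -> R) w :
  (forall m, psi m \in Lfun mu 2%:E) -> X w \in Lfun mu 2%:E ->
  (\int[mu]_t (residual psi w t ^+ 2)%:E =
   (dot mu (residual psi w) (residual psi w))%:E)%E.
Proof.
by move=> psiL XwL; rewrite EFin_dot ?residual_L2.
Qed.

Lemma measurable_residual_norm n (psi : 'I_n -> T -> R) :
  (forall m, psi m \in Lfun mu 2%:E) ->
  measurable_fun setT (fun w => (\int[mu]_t (residual psi w t ^+ 2)%:E)%E).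
Proof.
move=> psiL.
have mr : measurable_fun setT (fun z : Omega * T => residual psi z.1 z.2).
  apply: measurable_funB; first exact: sof_measurable XP.
  apply: measurable_sum => m; apply: measurable_funM.
  - by apply: measurableT_comp => //; exact: measurable_coef XP _ (psiL m).
  - by apply: measurableT_comp => //; exact: Lfun2_measurable (psiL m).
apply: (measurable_fun_fubini_tonelli_F
  (fun z => (residual psi z.1 z.2 ^+ 2)%:E)).
- by apply/measurable_EFinP; exact: measurable_funX.
- by move=> z; rewrite lee_fin sqr_ge0.
Qed.

(** The expectation of a quadratic form in uncorrelated coefficients only sees
    its diagonal. *)
Lemma sum_coef_cov (I : finType) (phi : I -> T -> R) (lambda : I -> R) (q : I -> I -> R) :
  orthonormal mu phi -> (forall i, eigenfunction mu U K (phi i) (lambda i)) ->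
  (\int[P]_w (\sum_i \sum_j q i j * (coef (phi i) w * coef (phi j) w))%:E =
   (\sum_i q i i * lambda i)%:E)%E.
Proof.
move=> [phiL phiO] phiE.
pose cc i j w : R := coef (phi i) w * coef (phi j) w.
have icc i j : P.-integrable setT (EFin \o cc i j).
  by apply: Lfun2_integrableM; exact: coef_L2 XP _ (phiL _).
have iq i j : P.-integrable setT (fun w => (q i j)%:E * (EFin \o cc i j) w)%E.
  exact: integrableZl.
transitivity (\sum_i \sum_j \int[P]_w ((q i j)%:E * (EFin \o cc i j) w))%E.
  rewrite [LHS](eq_integral
      (fun w => \sum_i \sum_j ((q i j)%:E * (EFin \o cc i j) w))%E); last first.
    move=> w _; rewrite -sumEFin; apply: eq_bigr => i _.
    by rewrite -sumEFin; apply: eq_bigr => j _; rewrite EFinM.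
  rewrite integral_sum// => [|i]; last exact: integrable_sum.
  by apply: eq_bigr => i _; rewrite integral_sum.
rewrite -sumEFin; apply: eq_bigr => i _.
rewrite (bigD1 i)//= big1 ?adde0 => [|j ji].
  rewrite integralZl//; last exact: icc.
  rewrite -EFin_dot; [|exact: coef_L2 XP _ (phiL _)..].
  by rewrite (coef_cov XP (phiL i) (phiE i)) phiO eqxx mulr1.
rewrite integralZl//; last exact: icc.
rewrite -EFin_dot; [|exact: coef_L2 XP _ (phiL _)..].
by rewrite (coef_cov XP (phiL i) (phiE j)) phiO eq_sym (negbTE ji) mulr0 mule0.
Qed.

(** Pythagoras on each path, then expectation.  The sum of the squared
    coefficients is moved to the left of the equation so that all integrands are
    nonnegative. *)
Lemma mean_sq_error_eigen n (phi : 'I_n -> T -> R) (lambda : 'I_n -> R) :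
  orthonormal mu phi -> (forall i, eigenfunction mu U K (phi i) (lambda i)) ->
  mean_sq_error phi = (kappa - \sum_i lambda i)%:E.
Proof.
move=> phiO phiE; have phiL := phiO.1.
suff : (mean_sq_error phi + (\sum_i lambda i)%:E = kappa%:E)%E.
  by move=> /(congr1 (fun x => x - (\sum_i lambda i)%:E)%E); rewrite addeK.
have sum_delta (F : 'I_n -> 'I_n -> R) : \sum_i \sum_j (i == j)%:R * F i j = \sum_i F i i.
  apply: eq_bigr => i _; rewrite (bigD1 i)//= eqxx mul1r big1 ?addr0// => j ji.
  by rewrite eq_sym (negbTE ji) mul0r.
have -> : \sum_i lambda i = \sum_i ((i == i)%:R * lambda i).
  by apply: eq_bigr => i _; rewrite eqxx mul1r.
rewrite -(sum_coef_cov (fun i j => (i == j)%:R) phiO phiE).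
rewrite -ge0_integralD//; last 4 first.
- by move=> w _; apply: integral_ge0 => t _; rewrite lee_fin sqr_ge0.
- exact: measurable_residual_norm.
- move=> w _; rewrite lee_fin sum_delta.
  by apply: sumr_ge0 => i _; rewrite -expr2 sqr_ge0.
- apply/measurable_EFinP; apply: measurable_sum => i; apply: measurable_sum => j.
  by apply: measurable_funM => //; apply: measurable_funM; exact: measurable_coef XP _ (phiL _).
rewrite -(second_moment XP); apply: ae_eq_integral => //.
- apply: emeasurable_funD; first exact: measurable_residual_norm.
  apply/measurable_EFinP; apply: measurable_sum => i; apply: measurable_sum => j.
  by apply: measurable_funM => //; apply: measurable_funM; exact: measurable_coef XP _ (phiL _).
- exact: measurable_path_norm XP.
- apply: filterS (path_L2 XP) => w XwL _.
  rewrite integral_residual// residualE dot_residual// -EFinD sum_delta.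
  rewrite (eq_bigr (fun i => coef (phi i) w ^+ 2)); last by move=> i _; rewrite expr2.
  by rewrite subrK EFin_dot//; apply: eq_integral => t _; rewrite expr2.
Qed.

(** Optimality of eigenfunctions in weak form.  The [p i] are the diagonal
    entries of the orthogonal projector p on the row space of the Gram matrix of
    psi against phi: Bessel's inequality bounds the error on a path below by
    [|x - z G|^2], with x and z the vectors of coefficients on phi and psi, and
    this is at least the quadratic form [x (1 - p) x^T]. *)
Lemma mean_sq_error_ge n N (psi : 'I_n -> T -> R) (phi : 'I_N -> T -> R)
    (lambda : 'I_N -> R) :
  (forall m, psi m \in Lfun mu 2%:E) -> orthonormal mu phi ->
  (forall i, eigenfunction mu U K (phi i) (lambda i)) ->
  exists p : 'I_N -> R, [/\ forall i, 0 <= p i <= 1, \sum_i p i <= n%:R &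
    ((\sum_i (1 - p i) * lambda i)%:E <= mean_sq_error psi)%E].
Proof.
move=> psiL phiO phiE; have phiL := phiO.1.
pose G : 'M[R]_(n, N) := \matrix_(m, i) dot mu (psi m) (phi i).
have [p [pT pp Gp ptr]] := ex_orthogonal_projector G.
exists (fun i => p i i); split => [i||]; [exact: projector_diag | exact: ptr |].
pose q i j := (1%:M - p) i j.
rewrite [X in X%:E](_ : _ = \sum_i q i i * lambda i); last first.
  by apply: eq_bigr => i _; rewrite /q !mxE eqxx.
rewrite -(sum_coef_cov q phiO phiE).
pose x w : 'rV[R]_N := \row_i coef (phi i) w.
have xE w : \sum_i \sum_j q i j * (coef (phi i) w * coef (phi j) w) =
    (x w *m (1%:M - p) *m (x w)^T) 0 0.
  rewrite mxE exchange_big; apply: eq_bigr => j _ /=.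
  rewrite !mxE big_distrl/=; apply: eq_bigr => i _; rewrite !mxE /q !mxE; ring.
have qx_ge0 w : 0 <= (x w *m (1%:M - p) *m (x w)^T) 0 0.
  by have /andP[] := projector_residual_le (x w) 0 pT pp Gp.
apply: ae_ge0_le_integral => //.
- by move=> w _; rewrite lee_fin xE.
- apply/measurable_EFinP; apply: measurable_sum => i; apply: measurable_sum => j.
  by apply: measurable_funM => //; apply: measurable_funM; exact: measurable_coef XP _ (phiL _).
- by move=> w _; apply: integral_ge0 => t _; rewrite lee_fin sqr_ge0.
- exact: measurable_residual_norm.
- apply: filterS (path_L2 XP) => w XwL _.
  rewrite integral_residual// lee_fin xE.
  pose z : 'rV[R]_n := \row_m coef (psi m) w.
  have /andP[_ /le_trans] := projector_residual_le (x w) z pT pp Gp; apply.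
  apply: le_trans (bessel phiO (residual_L2 psiL XwL)).
  apply: ler_sum => i _; rewrite residualE dotBl//; last first.
    by apply: Lfun2_sum => m; exact: Lfun2Z.
  rewrite dot_sumZl// !mxE le_eqVlt; apply/orP; left; apply/eqP.
  by congr ((_ - _) ^+ 2); apply: eq_bigr => m _; rewrite !mxE.
Qed.

End RankBounds.

(** * Integrals of characters over the cube *)

Section CubeCharacters.
Context {R : realType}.

Lemma tnth_cube_cons d (x : measurableTypeR R * d.-tuple R) :
  (tnth (cube_cons x) ord0 = x.1) *
  (forall i : 'I_d, tnth (cube_cons x) (lift ord0 i) = tnth x.2 i).
Proof. by split=> [|i]; rewrite /cube_cons ?tnth0 ?tnthS. Qed.

Lemma measurable_unit_cube d : measurable (@unit_cube R d).
Proof.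
rewrite (_ : unit_cube (d := d) =
  \bigcap_(i in [set: 'I_d]) ((fun t => tnth t i) @^-1` `[0, 1])).
  apply: fin_bigcap_measurable => [|i _]; first exact: finite_finset.
  by rewrite -[X in measurable X]setTI; exact: measurable_tnth.
by apply/seteqP; split=> t /= tU i => [_|]; [|move/(_ i I) in tU];
  rewrite /= in_itv/= in tU *.
Qed.

Lemma uniform01 : uniform_prob (@ltr01 R) `[0, 1] = 1%E.
Proof. by rewrite /uniform_prob integral_uniform_pdf1. Qed.

Lemma cube_measure_unit_cube d : cube_measure d (@unit_cube R d) = 1%E.
Proof.
elim: d => [|d IH].
  by rewrite /= diracE mem_set// => -[].
have mU := @measurable_unit_cube d.
rewrite /= /distribution /pushforward.
rewrite (_ : _ @^-1` _ = `[0, 1]%classic `*` @unit_cube R d); last first.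
  apply/seteqP; split=> -[x t] /= H.
    split; first by have := H ord0; rewrite tnth_cube_cons in_itv.
    by move=> i; have := H (lift ord0 i); rewrite tnth_cube_cons.
  move=> i; have [j ->|->] := unliftP ord0 i.
    by rewrite tnth_cube_cons; exact: H.2.
  by rewrite tnth_cube_cons; have := H.1; rewrite in_itv.
transitivity (uniform_prob (@ltr01 R) `[0%R, 1%R]%classic *
    cube_measure d (@unit_cube R d))%E.
  by apply: product_measure1E => //; exact: measurable_itv.
by rewrite IH mule1 uniform01.
Qed.

Lemma ae_unit_cube d : {ae cube_measure d, forall t, @unit_cube R d t}.
Proof.
have mU := @measurable_unit_cube d.
exists (~` @unit_cube R d); split => //; first exact: measurableC.
by rewrite probability_setC// cube_measure_unit_cube subee.
Qed.

Lemma sin_periodz (z : int) (a : R) : sin (2 * pi * z%:~R + a) = sin a.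
Proof.
have nat_case (n : nat) b : sin (2 * pi * n%:R + b) = sin b :> R.
  have -> : 2 * pi * n%:R = pi *+ 2 *+ n :> R.
    by rewrite mulr_natr mulr_natl.
  by rewrite addrC (periodicn (@sinD2pi R)).
case: z => n; first exact: nat_case.
rewrite -[LHS](nat_case n.+1) NegzE mulrNz -pmulrn; congr sin.
by rewrite mulrN addrA subrr add0r.
Qed.

Lemma integral_cst_uniform (c : R) :
  (\int[uniform_prob (@ltr01 R)]_x c%:E = c%:E)%E.
Proof.
rewrite integral_cst//.
by rewrite [X in (_ * X)%E](_ : _ = 1%E) ?mule1//; exact: probability_setT.
Qed.

Lemma integral_cos_uniform (m : int) (a : R) :
  (\int[uniform_prob (@ltr01 R)]_x (cos (2 * pi * m%:~R * x + a))%:E =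
   (if m == 0 then cos a else 0)%:E)%E.
Proof.
have [->|m0] := eqVneq m 0.
  rewrite (eq_integral (fun=> (cos a)%:E)); last first.
    by move=> x _; rewrite mulr0 mul0r add0r.
  by rewrite integral_cst_uniform.
pose k : R := 2 * pi * m%:~R.
have k0 : k != 0 by rewrite !mulf_neq0 ?intr_eq0// gt_eqF// pi_gt0.
(* nonnegative, so that its integral against the uniform law is a Lebesgue
   integral over the unit interval *)
pose f x : R := cos (k * x + a) + 1.
have f0 x : 0 <= f x by rewrite -lerBlDr sub0r cos_geN1.
have cf : continuous f.
  move=> x; apply: continuousD; last exact: cst_continuous.
  apply: continuous_comp; last exact: continuous_cos.
  apply: continuousD; last exact: cst_continuous.
  by apply: continuousM; [exact: cst_continuous|exact: cvg_id].
have mf : measurable_fun setT f by exact: continuous_measurable_fun.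
have mcos : measurable_fun setT (fun x => cos (k * x + a)).
  by rewrite (_ : (fun x => _) = f \- cst 1);
    [exact: measurable_funB|apply/funext => x; rewrite /f /= addrK].
have icos : (uniform_prob (@ltr01 R)).-integrable setT
    (EFin \o (fun x => cos (k * x + a))).
  by apply: (@bounded_integrable _ _ _ _ _ 1) => // x; exact: cos_max.
suff : (\int[uniform_prob (@ltr01 R)]_x (f x)%:E = 1)%E.
  under eq_integral do rewrite /f EFinD.
  rewrite integralD//; last exact: finite_measure_integrable_cst.
  rewrite integral_cst_uniform.
  by move/(congr1 (fun y => y - 1)%E); rewrite addeK// subee.
rewrite integral_uniform//; last exact/measurable_EFinP.
rewrite subr0 invr1 mul1e.
pose F x : R := sin (k * x + a) / k + x.
have dF (x : R) : is_derive x (1 : R) F (f x).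
  have dk : is_derive x (1 : R) (k *: (id : R -> R) + cst a) (k *: 1 + 0).
    by apply: is_deriveD.
  have ds : is_derive x (1 : R) (sin \o (k *: (id : R -> R) + cst a))
      (cos (k * x + a) * (k *: 1 + 0)).
    by apply: is_derive1_comp; exact: is_derive_sin.
  have dF := is_deriveD (is_deriveZ k^-1 ds) (is_derive_id x (1 : R)).
  rewrite (_ : F = k^-1 *: (sin \o (k *: (id : R -> R) + cst a)) + id).
    apply: is_derive_eq.
    by rewrite /f addr0 scaler1 /GRing.scale/= mulrCA mulVf// mulr1.
  by apply/funext => y; rewrite /F mulrC.
rewrite (@continuous_FTC2 _ f F)//; last 3 first.
- exact: continuous_subspaceT.
- have cF : continuous F.
    by move=> x; apply/differentiable_continuous/derivable1_diffP; exact: ex_derive.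
  split => [x _||]; first exact: ex_derive.
  + exact/cvg_at_right_filter/cF.
  + exact/cvg_at_left_filter/cF.
- by move=> x _; rewrite derive1E; exact: derive_val.
rewrite /F mulr1 mulr0 sin_periodz add0r -EFinB; congr EFin; ring.
Qed.

(** The real part of a character of the torus, with a phase a.  Waves, their
    products and the terms of the Korobov kernel are all of this form up to
    scalars, so that a single integral settles every orthogonality relation. *)
Definition character d (m : 'I_d -> int) (a : R) (t : d.-tuple R) : R :=
  cos (2 * pi * (\sum_(i < d) (m i)%:~R * tnth t i) + a).

Lemma measurable_character d (m : 'I_d -> int) a :
  measurable_fun setT (character m a).
Proof.
apply: (measurableT_comp (continuous_measurable_fun (@continuous_cos R))).
apply: measurable_funD => //; apply: measurable_funM => //.
apply: measurable_sum => i; apply: measurable_funM => //.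
exact: measurable_tnth.
Qed.

Lemma character_le1 d (m : 'I_d -> int) a t : `|character m a t| <= 1.
Proof. exact: cos_max. Qed.

Lemma integrable_character d (m : 'I_d -> int) a :
  (cube_measure d).-integrable setT (EFin \o character m a).
Proof.
apply: (@bounded_integrable _ _ _ _ _ 1); first exact: measurable_character.
exact: character_le1.
Qed.

Lemma integral_character d (m : 'I_d -> int) a :
  (\int[cube_measure d]_t (character m a t)%:E =
   (if [forall i, m i == 0] then cos a else 0)%:E)%E.
Proof.
elim: d m a => [|d IH] m a.
  rewrite /= integral_dirac//; last first.
    by apply/measurable_EFinP; exact: measurable_character.
  rewrite diracT mul1e /character big_ord0 mulr0 add0r.
  by rewrite ifT//; apply/forallP => -[].
have E (x : measurableTypeR R * d.-tuple R) : character m a (cube_cons x) =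
    character (m \o lift ord0) (2 * pi * (m ord0)%:~R * x.1 + a) x.2.
  rewrite /character big_ord_recl tnth_cube_cons.
  rewrite (eq_bigr (fun i => ((m \o lift ord0) i)%:~R * tnth x.2 i)); last first.
    by move=> i _; rewrite tnth_cube_cons.
  by congr cos; ring.
have iE : (uniform_prob (@ltr01 R) \x cube_measure d)%E.-integrable setT
    (EFin \o (fun x => character m a (cube_cons x))).
  pose nu : probability _ R := (uniform_prob (@ltr01 R) \x cube_measure d)%E.
  apply: (@bounded_integrable _ _ _ nu _ 1); last by move=> x; exact: character_le1.
  apply: measurableT_comp; first exact: measurable_character.
  exact: measurable_cube_cons.
rewrite /= integral_distribution//; last first.
  by apply/measurable_EFinP; exact: measurable_character.
rewrite -(integral12_prod_meas1 iE).
transitivity (\int[uniform_prob (@ltr01 R)]_x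
    (if [forall i, (m \o lift ord0) i == 0]
     then cos (2 * pi * (m ord0)%:~R * x + a) else 0)%:E)%E.
  apply: eq_integral => x _; rewrite /fubini_F /= -IH.
  by apply: eq_integral => t _; rewrite E.
have [m'0|m'0] := boolP [forall i, (m \o lift ord0) i == 0].
  rewrite integral_cos_uniform; congr (_%:E); congr (if _ then _ else _).
  apply/idP/forallP => [m00 i|/(_ ord0)//].
  by have [j ->|->//] := unliftP ord0 i; exact: (forallP m'0).
rewrite integral_cst_uniform ifN//; apply: contra m'0 => /forallP m0.
by apply/forallP => i; exact: m0.
Qed.

End CubeCharacters.

(** * The series of the Korobov kernel *)

Section KorobovSeries.
Context {R : realType}.

(** The integral test without the integral:
    [(x / y)^(1 - s) = exp ((s - 1) (ln y - ln x)) >= 1 + (s - 1) / y]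
    for [y = x + 1]. *)
Lemma powRN_telescope (s : R) (k : nat) : 1 < s -> (0 < k)%N ->
  k.+1%:R `^ (- s) <= (s - 1)^-1 * (k%:R `^ (1 - s) - k.+1%:R `^ (1 - s)).
Proof.
move=> s1 k0; set x : R := k%:R; set y : R := k.+1%:R.
have x0 : 0 < x by rewrite ltr0n.
have y0 : 0 < y by rewrite ltr0n.
have a0 : 0 < s - 1 by rewrite subr_gt0.
rewrite mulrC ler_pdivlMr//.
have -> : x `^ (1 - s) = y `^ (1 - s) * expR ((s - 1) * (ln y - ln x)).
  by rewrite /powR !gt_eqF// -expRD; congr expR; ring.
have -> : y `^ (- s) = y `^ (1 - s) * y^-1.
  rewrite -powR_inv1 ?ltW// -powRD; last by rewrite (gt_eqF y0) implybT.
  by rewrite addrAC subrr add0r.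
rewrite -mulrA -[X in _ <= _ - X]mulr1 -mulrBr ler_pM2l ?powR_gt0//.
rewrite lerBrDl; apply: le_trans (expR_ge1Dx _).
rewrite lerD2l mulrC ler_pM2l//.
have yx : y = x + 1 by rewrite /y -natr1.
have xy0 : 0 < x / y by rewrite divr_gt0.
have := @le_ln1Dx _ (x / y - 1); rewrite ltrBrDl subrr => /(_ xy0).
rewrite addrC subrK ln_div ?posrE// => lnxy.
rewrite (_ : y^-1 = 1 - x / y); first by rewrite -lerN2 !opprB.
by rewrite yx; field; rewrite -yx gt_eqF.
Qed.

(** This one bound gives both the convergence of the series for every [s > 1]
    and the fact that its tail from [k = 2] on vanishes as s grows. *)
Lemma sum_powRN_le (s : R) (n : nat) : 1 < s ->
  \sum_(2 <= k < n) k%:R `^ (- s) <= (s - 1)^-1.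
Proof.
move=> s1; have a0 : 0 < s - 1 by rewrite subr_gt0.
apply: (@le_trans _ _ ((s - 1)^-1 * (1 - n.-1%:R `^ (1 - s)))); last first.
  by apply: ler_piMr; rewrite ?invr_ge0 ?gerBl ?powR_ge0 ?ltW.
elim: n => [|n IH].
  by rewrite big_geq// powR0 ?subr0 ?mulr1 ?invr_ge0 ?ltW// lt_eqF// subr_lt0.
have [n1|n1] := leqP n 1.
  rewrite big_geq//; case: n n1 {IH} => [|[|//]] _ /=.
    by rewrite powR0 ?subr0 ?mulr1 ?invr_ge0 ?ltW// lt_eqF// subr_lt0.
  by rewrite powR1 subrr mulr0.
case: n n1 IH => // n n1 IH; rewrite big_nat_recr//=.
apply: le_trans (lerD IH (powRN_telescope s1 n1)) _.
by rewrite -mulrDr/= addrA subrK.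
Qed.

Lemma korobov_term0 (s : R) x : 1 < s -> (0%:R : R) `^ (- s) * x = 0.
Proof. by move=> s1; rewrite powR0 ?mul0r// oppr_eq0 gt_eqF// (lt_trans ltr01). Qed.

Lemma sum_powRN_abs (s : R) (n : nat) (c : nat -> R) : 1 < s ->
  (forall k, `|c k| <= 1) ->
  \sum_(1 <= k < n) `|k%:R `^ (- s) * c k| <= 1 + (s - 1)^-1.
Proof.
move=> s1 c1; have [n1|n1] := leqP n 1.
  by rewrite ?big_nil ?big_geq// addr_ge0// invr_ge0 subr_ge0 ltW.
have term_le k : `|k%:R `^ (- s) * c k| <= k%:R `^ (- s).
  by rewrite normrM (ger0_norm (powR_ge0 _ _)) ler_piMr ?powR_ge0.
rewrite big_ltn//; apply: lerD.
  by apply: le_trans (term_le _) _; rewrite powR1.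
by apply: le_trans (sum_powRN_le n s1); apply: ler_sum => k _.
Qed.

Lemma cvg_korobov (s : R) (c : nat -> R) : 1 < s -> (forall k, `|c k| <= 1) ->
  cvgn (fun n => \sum_(1 <= k < n) k%:R `^ (- s) * c k).
Proof.
move=> s1 c1; pose u k := k%:R `^ (- s) * c k.
have -> : (fun n => \sum_(1 <= k < n) k%:R `^ (- s) * c k) = series u.
  apply/funext => -[|n]; first by rewrite /series/= !big_geq.
  by rewrite /series/= [RHS]big_ltn// /u korobov_term0// add0r.
apply: normed_cvg; apply: nondecreasing_is_cvgn.
  by apply: nondecreasing_series => *; exact: normr_ge0.
exists (1 + (s - 1)^-1) => _ [n _ <-].
apply: le_trans (sum_powRN_abs n s1 c1).
rewrite -[leLHS]/(\sum_(0 <= k < n) `|u k|).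
case: n => [|n]; first by rewrite !big_geq.
by rewrite big_ltn// /u korobov_term0// normr0 add0r.
Qed.

End KorobovSeries.

(** * Spectrum of the additive Korobov kernel *)

Section PartialKernels.
Context {R : realType}.
Variables (alpha beta sigma : nat -> R) (d : nat).
Hypothesis sigma_gt1 : forall j, (0 < j)%N -> 1 < sigma j.

Definition partial_kernel (n : nat) (t s : d.-tuple R) : R :=
  \sum_(i < d) (alpha i.+1 + 2 * beta i.+1 * \sum_(1 <= k < n)
    k%:R `^ (- sigma i.+1) * cos (2 * pi * k%:R * (tnth t i - tnth s i))).

Local Notation K := (additive_korobov alpha beta sigma (d := d)).

Lemma cvg_partial_kernel t s : partial_kernel n t s @[n --> \oo] --> K t s.
Proof.
apply: cvg_big => [|i _]; first exact: add_continuous.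
apply: cvgD; first exact: cvg_cst.
apply: cvgM; first exact: cvg_cst.
by apply: cvg_korobov => [|k]; [exact: sigma_gt1|exact: cos_max].
Qed.

Definition kernel_bound : R :=
  \sum_(i < d) (`|alpha i.+1| + `|2 * beta i.+1| * (1 + (sigma i.+1 - 1)^-1)).

Lemma partial_kernel_le n t s : `|partial_kernel n t s| <= kernel_bound.
Proof.
apply: le_trans (ler_norm_sum _ _ _) _; apply: ler_sum => i _.
apply: le_trans (ler_normD _ _) _; rewrite lerD2l normrM ler_wpM2l//.
apply: le_trans (ler_norm_sum _ _ _) _.
by apply: sum_powRN_abs => [|k]; [exact: sigma_gt1|exact: cos_max].
Qed.

Lemma measurable_partial_kernel n t : measurable_fun setT (partial_kernel n t).
Proof.
apply: measurable_sum => i; apply: measurable_funD => //.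
apply: measurable_funM => //; apply: measurable_sum => k.
apply: measurable_funM => //.
apply: (measurableT_comp (continuous_measurable_fun (@continuous_cos R))).
apply: measurable_funM => //; apply: measurable_funB => //.
exact: measurable_tnth.
Qed.

Lemma measurable_kernel t : measurable_fun setT (K t).
Proof.
apply: (measurable_fun_cvg (h := fun n => partial_kernel n t)).
- by move=> n; exact: measurable_partial_kernel.
- by move=> s _; exact: cvg_partial_kernel.
Qed.

Lemma kernel_le t s : `|K t s| <= kernel_bound.
Proof.
have le_n n : - kernel_bound <= partial_kernel n t s <= kernel_bound.
  by rewrite -ler_norml partial_kernel_le.
rewrite ler_norml; apply/andP; split.
- apply: (cvgr_to_ge (@cvg_partial_kernel t s)); apply: nearW => n.
  by have /andP[] := le_n n.
- apply: (cvgr_to_le (@cvg_partial_kernel t s)); apply: nearW => n.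
  by have /andP[] := le_n n.
Qed.

(** Dominated convergence.  The partial kernels satisfy the eigenfunction
    equations exactly as soon as they contain the frequency 1, whence the
    condition [1 < n]. *)
Lemma integral_kernel_lim (psi : d.-tuple R -> R) t (v : R) :
  measurable_fun setT psi -> (forall s, `|psi s| <= 1) ->
  (forall n, (1 < n)%N ->
    (\int[cube_measure d]_s (partial_kernel n t s * psi s)%:E = v%:E)%E) ->
  (\int[cube_measure d]_s (K t s * psi s)%:E = v%:E)%E.
Proof.
move=> mpsi psi1 Hv.
have mK n := measurable_funM (measurable_partial_kernel n t) mpsi.
have [//|||||_ _ H] := @dominated_convergence _ _ R (cube_measure d) setT measurableT
  (fun n s => (partial_kernel n t s * psi s)%:E) (fun s => (K t s * psi s)%:E)
  (fun=> kernel_bound%:E).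
- by move=> n; apply/measurable_EFinP; exact: mK.
- by apply/measurable_EFinP; exact: measurable_funM (measurable_kernel t) mpsi.
- apply: aeW => s _; apply: cvg_EFin; first by apply: nearW.
  by apply: cvgM; [exact: cvg_partial_kernel|exact: cvg_cst].
- exact: finite_measure_integrable_cst.
- apply: aeW => s n _; rewrite lee_fin normrM -[leRHS]mulr1.
  by apply: ler_pM => //; exact: partial_kernel_le.
rewrite -(cvg_lim (@ereal_hausdorff R) H).
by apply: lim_near_cst => //; exists 2%N => // n /= n2; exact: Hv.
Qed.

End PartialKernels.

Section Characters.
Context {R : realType} (d : nat).

Lemma character_mul (m m' : 'I_d -> int) (a a' : R) t :
  character m a t * character m' a' t =
  2^-1 * (character (fun i => m i + m' i) (a + a') t +
          character (fun i => m i - m' i) (a - a') t).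
Proof.
rewrite /character; set x := 2 * pi * _ + a; set y := 2 * pi * _ + a'.
rewrite (_ : 2 * pi * _ + (a + a') = x + y); last first.
  rewrite (eq_bigr (fun i => (m i)%:~R * tnth t i + (m' i)%:~R * tnth t i)).
    by rewrite big_split mulrDr addrACA.
  by move=> i _; rewrite rmorphD mulrDl.
rewrite (_ : 2 * pi * _ + (a - a') = x - y); last first.
  rewrite (eq_bigr (fun i => (m i)%:~R * tnth t i - (m' i)%:~R * tnth t i)).
    by rewrite sumrB mulrBr addrACA -opprD.
  by move=> i _; rewrite rmorphB mulrBl.
by clearbody x y; rewrite cosD cosB; field.
Qed.

Lemma integral_character_mul (m m' : 'I_d -> int) (a a' : R) :
  (\int[cube_measure d]_t (character m a t * character m' a' t)%:E =
   (2^-1 * ((if [forall i, m i + m' i == 0] then cos (a + a') else 0) +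
            (if [forall i, m i - m' i == 0] then cos (a - a') else 0)))%:E)%E.
Proof.
rewrite EFinM EFinD -!integral_character -integralD//; last 2 first.
- exact: integrable_character.
- exact: integrable_character.
rewrite -integralZl//; last by apply: integrableD => //; exact: integrable_character.
by apply: eq_integral => t _; rewrite -EFinD -EFinM character_mul.
Qed.

Definition axis_freq (i : 'I_d) (k : nat) (l : 'I_d) : int :=
  if l == i then k%:Z else 0.

Lemma sum_axis_freq i k (t : d.-tuple R) :
  \sum_(l < d) (axis_freq i k l)%:~R * tnth t l = k%:R * tnth t i.
Proof.
rewrite (bigD1 i)//= /axis_freq eqxx big1 ?addr0// => l /negbTE ->.
by rewrite mul0r.
Qed.

Lemma axis_freqD_eq0 i j k k' : (0 < k)%N ->
  [forall l, axis_freq i k l + axis_freq j k' l == 0] = false.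
Proof.
move=> k0; apply/negbTE/forallPn; exists i; rewrite /axis_freq eqxx.
by case: ifP => _; lia.
Qed.

Lemma axis_freqB_eq0 i j k k' : (0 < k)%N ->
  [forall l, axis_freq i k l - axis_freq j k' l == 0] = (i == j) && (k == k').
Proof.
move=> k0; apply/forallP/andP => [/(_ i)|[/eqP -> /eqP -> l]]; last by rewrite subrr.
by rewrite /axis_freq eqxx; have [_|_] := eqVneq i j => H; [split=> //|]; lia.
Qed.

Lemma axis_freq0_eq0 i k : (0 < k)%N -> [forall l, axis_freq i k l == 0] = false.
Proof.
move=> k0; apply/negbTE/forallPn; exists i.
by rewrite /axis_freq eqxx; lia.
Qed.

Lemma wave_character i k (t s : d.-tuple R) :
  cos (2 * pi * k%:R * (tnth t i - tnth s i)) =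
  character (axis_freq i k) (- (2 * pi * k%:R * tnth t i)) s.
Proof. by rewrite /character sum_axis_freq -cosN; congr cos; ring. Qed.

End Characters.

Section EigenSystem.
Context {R : realType}.
Variables (alpha beta sigma : nat -> R) (d : nat).
Hypothesis sigma_gt1 : forall j, (0 < j)%N -> 1 < sigma j.

Local Notation mu := (cube_measure (R := R) d).
Local Notation K := (additive_korobov alpha beta sigma (d := d)).

Lemma character_L2 (m : 'I_d -> int) (a : R) : character m a \in Lfun mu 2%:E.
Proof. exact: bounded_Lfun2 (measurable_character m a) (character_le1 m a). Qed.

Lemma cst1_character : cst 1 = character (fun _ : 'I_d => 0) (0 : R).
Proof.
apply/funext => t; rewrite /character big1 ?mulr0 ?addr0 ?cos0// => i _.
by rewrite mul0r.
Qed.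

Lemma dot_character (m m' : 'I_d -> int) (a a' : R) :
  dot mu (character m a) (character m' a') =
   2^-1 * ((if [forall i, m i + m' i == 0] then cos (a + a') else 0) +
            (if [forall i, m i - m' i == 0] then cos (a - a') else 0)).
Proof.
by apply: EFin_inj; rewrite EFin_dot ?character_L2// integral_character_mul.
Qed.

Lemma partial_kernelE n (t : d.-tuple R) : partial_kernel alpha beta sigma n t =
  \sum_(i < d) (alpha i.+1 *: cst 1 + \sum_(1 <= k < n)
    (2 * beta i.+1 * k%:R `^ (- sigma i.+1)) *:
      character (axis_freq i k) (- (2 * pi * k%:R * tnth t i))).
Proof.
apply/funext => s; rewrite /partial_kernel fct_sumE; apply: eq_bigr => i _.
rewrite !fctE fct_sumE; congr (_ + _); first by rewrite /GRing.scale /= mulr1.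
rewrite mulr_sumr; apply: eq_bigr => k _.
by rewrite wave_character mulrA.
Qed.

Lemma dot_partial_kernel n t (m' : 'I_d -> int) (a' : R) :
  dot mu (partial_kernel alpha beta sigma n t) (character m' a') =
  \sum_(i < d) (alpha i.+1 * dot mu (cst 1) (character m' a') +
    \sum_(1 <= k < n) 2 * beta i.+1 * k%:R `^ (- sigma i.+1) *
      dot mu (character (axis_freq i k) (- (2 * pi * k%:R * tnth t i)))
             (character m' a')).
Proof.
have c1 : (cst 1 : d.-tuple R -> R) \in Lfun mu 2%:E by exact: Lfun_cst.
have tailL (i : 'I_d) : \sum_(1 <= k < n) (2 * beta i.+1 * k%:R `^ (- sigma i.+1)) *:
      character (axis_freq i k) (- (2 * pi * k%:R * tnth t i)) \in Lfun mu 2%:E.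
  by apply: Lfun2_sum => k; apply: Lfun2Z; exact: character_L2.
rewrite partial_kernelE dot_suml; last 2 first.
- by move=> i; apply: Lfun2D; [exact: Lfun2Z|exact: tailL].
- exact: character_L2.
apply: eq_bigr => i _; rewrite dotDl ?Lfun2Z ?character_L2//.
by rewrite dotZl ?character_L2// dot_sumZl ?character_L2// => k; exact: character_L2.
Qed.

Lemma partial_kernel_L2 n t : partial_kernel alpha beta sigma n t \in Lfun mu 2%:E.
Proof.
apply: bounded_Lfun2 (measurable_partial_kernel _ _ _ _ _) _ => s.
exact: partial_kernel_le.
Qed.

Lemma eigen_cst : eigenfunction mu (@unit_cube R d) K (cst 1) (\sum_(i < d) alpha i.+1).
Proof.
split; first exact: Lfun_cst.
move=> t _; apply: integral_kernel_lim => // [s|n _]; first by rewrite /= normr1.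
rewrite -EFin_dot; [|exact: partial_kernel_L2|exact: Lfun_cst].
congr EFin; rewrite {1}cst1_character dot_partial_kernel mulr1.
apply: eq_bigr => i _; rewrite cst1_character dot_character.
rewrite [X in _ + X]big1_seq ?addr0 => [|k /andP[_]].
  rewrite !ifT ?addr0 ?subr0 ?cos0; first by field.
  - by apply/forallP => l.
  - by apply/forallP => l.
rewrite mem_index_iota => /andP[k0 _]; rewrite dot_character.
under eq_forallb do rewrite /= addr0.
under [X in _ + if X then _ else _]eq_forallb do rewrite /= ?subr0 ?addr0.
by rewrite axis_freq0_eq0// addr0 !mulr0.
Qed.

(** The boolean selects the phase: [true] turns the cosine into a sine. *)
Definition wave (p : 'I_d * bool) : d.-tuple R -> R :=
  Num.sqrt 2 *: character (axis_freq p.1 1) (- (if p.2 then pi / 2 else 0)).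

Lemma wave_L2 p : wave p \in Lfun mu 2%:E.
Proof. by apply: Lfun2Z; exact: character_L2. Qed.

(** Among all the terms of the kernel, only the one of frequency 1 in the same
    coordinate is not orthogonal to the wave; its factor 2 compensates the
    factor 1/2 of the product formula. *)
Lemma eigen_wave p : eigenfunction mu (@unit_cube R d) K (wave p) (beta p.1.+1).
Proof.
split; first exact: wave_L2.
case: p => j b t _; rewrite /wave /=; set a := - (if b then _ else _).
set chi := character (axis_freq j 1) a.
transitivity ((Num.sqrt 2)%:E * \int[mu]_s (K t s * chi s)%:E)%E.
  rewrite -integralZl//; first by apply: eq_integral => s _; rewrite -EFinM mulrCA.
  apply: (@bounded_integrable _ _ _ _ _ (kernel_bound alpha beta sigma d)).
    by apply: measurable_funM; [exact: measurable_kernel|exact: measurable_character].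
  move=> s; rewrite normrM -[leRHS]mulr1; apply: ler_pM => //; last exact: character_le1.
  exact: kernel_le.
rewrite (@integral_kernel_lim _ _ _ _ _ sigma_gt1 chi t (beta j.+1 * chi t)).
- by rewrite -EFinM; congr EFin; rewrite mulrCA.
- exact: measurable_character.
- exact: character_le1.
move=> n n1; rewrite -EFin_dot; [|exact: partial_kernel_L2|exact: character_L2].
congr EFin; rewrite dot_partial_kernel cst1_character.
rewrite (bigD1 j)//= [X in _ + X]big1 ?addr0 => [|i ij].
  rewrite dot_character.
  under eq_forallb do rewrite /= add0r.
  rewrite axis_freq0_eq0//.
  rewrite (_ : [forall l, _] = false); last first.
    apply/negbTE/forallPn; exists j; rewrite /axis_freq eqxx; lia.
  rewrite addr0 !mulr0 add0r big_ltn// big1_seq ?addr0 => [|k /andP[_]].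
    rewrite dot_character axis_freqD_eq0// axis_freqB_eq0// !eqxx/= powR1 add0r.
    rewrite /chi /character sum_axis_freq -[cos (- _ - _)]cosN.
    rewrite (_ : - (- _ - a) = 2 * pi * (1 * tnth t j) + a); last by ring.
    by field.
  rewrite mem_index_iota => /andP[k1 _]; rewrite dot_character.
  rewrite axis_freqD_eq0 ?axis_freqB_eq0 ?(ltn_trans _ k1)//.
  by rewrite (gtn_eqF k1) andbF addr0 !mulr0.
rewrite big1_seq ?addr0 => [|k /andP[_]]; last first.
  rewrite mem_index_iota => /andP[k0 _]; rewrite dot_character.
  by rewrite axis_freqD_eq0 ?axis_freqB_eq0// (negbTE ij) addr0 !mulr0.
rewrite dot_character.
under eq_forallb do rewrite /= add0r.
rewrite axis_freq0_eq0//.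
rewrite (_ : [forall l, _] = false); first by rewrite addr0 !mulr0.
by apply/negbTE/forallPn; exists j; rewrite /axis_freq eqxx; lia.
Qed.

Definition eigenfun (o : option ('I_d * bool)) : d.-tuple R -> R :=
  if o is Some p then wave p else cst 1.

Definition eigenval (o : option ('I_d * bool)) : R :=
  if o is Some p then beta p.1.+1 else \sum_(i < d) alpha i.+1.

Lemma eigenfunP o : eigenfunction mu (@unit_cube R d) K (eigenfun o) (eigenval o).
Proof. by case: o => [p|]; [exact: eigen_wave|exact: eigen_cst]. Qed.

Lemma dot_cst_wave p : dot mu (cst 1) (wave p) = 0.
Proof.
rewrite dotC dotZl ?character_L2//; last exact: Lfun_cst.
rewrite cst1_character dot_character.
under eq_forallb do rewrite /= addr0.
under [X in _ + if X then _ else _]eq_forallb do rewrite /= ?subr0 ?addr0.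
by rewrite axis_freq0_eq0// addr0 !mulr0.
Qed.

Lemma dot_wave p q : dot mu (wave p) (wave q) = (p == q)%:R.
Proof.
rewrite dotZl ?character_L2//; last exact: wave_L2.
rewrite dotC dotZl ?character_L2// dot_character.
rewrite axis_freqD_eq0// axis_freqB_eq0// eqxx andbT add0r.
case: p q => i b [j b'] /=; rewrite xpair_eqE [i == j]eq_sym.
case: (j == i) => /=; last by rewrite !mulr0.
rewrite mulrA mulrA -expr2 sqr_sqrtr// mulfV// mul1r.
by case: b; case: b'; rewrite ?opprK ?oppr0 ?addNr ?addr0 ?add0r ?subrr ?subr0
  ?cosN ?cos0 ?cos_pihalf.
Qed.

Lemma eigenfun_orthonormal : orthonormal mu eigenfun.
Proof.
split=> [[p|]|[p|] [q|]] /=; first exact: wave_L2.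
- exact: Lfun_cst.
- exact: dot_wave.
- by rewrite dotC dot_cst_wave.
- exact: dot_cst_wave.
- rewrite /dot /= mulr1 Rintegral_cst// mul1r [X in fine X](_ : _ = 1%E)//.
  exact: probability_setT.
Qed.

End EigenSystem.

(** * Admissible numbers of functionals *)

Lemma expe2_poweR (R : realType) (x : \bar R) : (0 <= x -> x ^+ 2 = x `^ 2)%E.
Proof.
case: x => [x||]//=; rewrite ?lee_fin => x0.
  by rewrite powR_mulrn// -EFin_expe.
by rewrite pnatr_eq0 /= mulyy.
Qed.

Section Admissibility.
Context {R : realType} (dO : measure_display) (Omega : measurableType dO).
Variables (P : probability Omega R) (d : nat).
Variables (B : Omega -> d.-tuple R -> R) (K : d.-tuple R -> d.-tuple R -> R).
Variable (kappa eps : R).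
Hypothesis BK : second_order_field P (cube_measure d) B (@unit_cube R d) K kappa.
Hypothesis eps_ge0 : 0 <= eps.

Lemma rms_normE (Y : Omega -> d.-tuple R -> R) :
  rms_norm P Y = ((\int[P]_w \int[cube_measure d]_t (Y w t ^+ 2)%:E) `^ 2^-1)%E.
Proof.
rewrite /rms_norm; congr (_ `^ _)%E; apply: eq_integral => w _.
rewrite expe2_poweR ?Lnorm_ge0// powR_Lnorm//.
by apply: eq_integral => t _; rewrite /= powR_mulrn// -normrX ger0_norm ?sqr_ge0.
Qed.

Lemma kappa_ge0 : 0 <= kappa.
Proof.
rewrite -lee_fin -(second_moment BK); apply: integral_ge0 => w _.
by apply: integral_ge0 => t _; rewrite lee_fin sqr_ge0.
Qed.

Lemma approx_error0 : (eps%:E * approx_error P B 0 = ((eps ^+ 2 * kappa) `^ 2^-1)%:E)%E.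
Proof.
rewrite /approx_error rms_normE (second_moment BK) poweR_EFin -EFinM; congr EFin.
rewrite powRM ?sqr_ge0 ?kappa_ge0//; congr (_ * _).
by rewrite -powR_mulrn// -powRrM mulfV// powRr1.
Qed.

Lemma mean_sq_error_ge0 n (psi : 'I_n -> d.-tuple R -> R) :
  (0 <= mean_sq_error P (cube_measure d) B psi)%E.
Proof.
apply: integral_ge0 => w _.
by apply: integral_ge0 => t _; rewrite lee_fin sqr_ge0.
Qed.

Lemma admissible_eigen n (phi : 'I_n -> d.-tuple R -> R) (lambda : 'I_n -> R) :
  (0 < n)%N -> orthonormal (cube_measure d) phi ->
  (forall i, eigenfunction (cube_measure d) (@unit_cube R d) K (phi i) (lambda i)) ->
  kappa - \sum_i lambda i <= eps ^+ 2 * kappa ->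
  admissible P B eps n.
Proof.
move=> n0 phiO phiE le_eps; split=> //; rewrite approx_error0.
rewrite -[X in approx_error _ _ X](prednK n0) /approx_error (prednK n0).
apply: (@le_trans _ _ (rms_norm P (residual (cube_measure d) B phi))).
  apply: ereal_inf_lbound; exists phi => //=.
  exact: phiO.1.
rewrite rms_normE -/(mean_sq_error P (cube_measure d) B phi).
rewrite (mean_sq_error_eigen BK phiO phiE) poweR_EFin lee_fin.
have := mean_sq_error_ge0 phi; rewrite (mean_sq_error_eigen BK phiO phiE) lee_fin => err0.
by rewrite ge0_ler_powR// nnegrE// mulr_ge0 ?sqr_ge0 ?kappa_ge0.
Qed.

(** A lower bound common to all families psi passes to the infimum.  When
    [v <= 0] there is nothing to prove; otherwise the square root is strictly
    increasing between the two sides. *)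
Lemma admissible_lower n (v : R) : admissible P B eps n ->
  (forall psi : 'I_n -> d.-tuple R -> R,
    (forall m, psi m \in Lfun (cube_measure d) 2%:E) ->
    (v%:E <= mean_sq_error P (cube_measure d) B psi)%E) ->
  v <= eps ^+ 2 * kappa.
Proof.
have ek0 : 0 <= eps ^+ 2 * kappa by rewrite mulr_ge0 ?sqr_ge0 ?kappa_ge0.
have [v0 _ _|v0] := leP v 0; first exact: le_trans ek0.
move=> [n0]; rewrite approx_error0 => err_le Hv.
have : ((v `^ 2^-1)%:E <= ((eps ^+ 2 * kappa) `^ 2^-1)%:E)%E.
  apply: le_trans err_le; case: n n0 Hv => // n _ Hv.
  apply: le_ereal_inf_tmp => _ [psi psiL <-]; rewrite rms_normE -poweR_EFin.
  apply: gt0_ler_poweR => //; rewrite ?in_itv/= ?leey ?lee_fin ?andbT ?(ltW v0)//.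
  - exact: mean_sq_error_ge0.
  - exact: Hv.
rewrite lee_fin => sqrt_le.
rewrite leNgt; apply/negP => v_gt.
have half_gt0 : 0 < 2^-1 :> R by rewrite invr_gt0.
have := gt0_ltr_powR half_gt0 _ _ v_gt; rewrite !nnegrE ltNge sqrt_le ek0 (ltW v0).
by move/(_ isT isT).
Qed.

Lemma complexityP n0 : admissible P B eps n0 ->
  admissible P B eps (complexity P B eps) /\ (complexity P B eps <= n0)%N.
Proof.
move=> adm0; rewrite /complexity; case: xgetP => [m _ [admm minm]|none].
  by split=> //; exact: minm.
exfalso; have ex : exists n, `[< admissible P B eps n >] by exists n0; apply/asboolP.
case: (ex_minnP ex) => m /asboolP admm minm; apply: (none m); split=> // k admk.
by apply: minm; apply/asboolP.
Qed.

End Admissibility.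

Section KorobovComplexity.
Context {R : realType} (dO : measure_display) (Omega : measurableType dO).
Variables (P : probability Omega R) (alpha beta sigma : nat -> R) (d : nat).
Variables (B : Omega -> d.-tuple R -> R) (eps : R).
Hypothesis sigma_gt1 : forall j, (0 < j)%N -> 1 < sigma j.
Hypothesis BK : centered_field P (additive_korobov alpha beta sigma (d := d)) B.
Hypothesis eps_ge0 : 0 <= eps.

(** The kernel depends on [t - s] only, so its diagonal is the value at the
    origin. *)
Definition korobov_diag (j : nat) : R := korobov (alpha j) (beta j) (sigma j) 0 0.

Local Notation kappa := (\sum_(i < d) korobov_diag i.+1).

Lemma centered_second_order : second_order_field P (cube_measure d) B
  (@unit_cube R d) (additive_korobov alpha beta sigma (d := d)) kappa.
Proof.
split.
- exact: field_measurable BK.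
- exact: ae_unit_cube.
- exact: field_L2 BK.
- move=> t s Ut Us; have := field_cov BK Ut Us.
  rewrite unlock (field_mean BK Ut) (field_mean BK Us) unlock => cov_ts.
  rewrite /dot /Rintegral; transitivity (fine (additive_korobov alpha beta sigma t s)%:E) => //.
  rewrite -cov_ts; congr fine; apply: eq_integral => w _.
  by rewrite !fctE /= !subr0.
- by move=> t _; exact: measurable_kernel.
- move=> t _; apply: eq_bigr => i _; rewrite /korobov_diag /korobov.
  by rewrite !subrr.
Qed.

(** The approximation projects on the constant and on the two waves in each of
    the first m coordinates. *)
Lemma admissible_truncation m : (m <= d)%N ->
  kappa - \sum_(i < d) alpha i.+1 - 2 * \sum_(i < m) beta i.+1 <= eps ^+ 2 * kappa ->
  admissible P B eps m.*2.+1.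
Proof.
move=> md le_eps; pose I : finType := (unit + 'I_m * bool)%type.
have cardI : #|I| = m.*2.+1.
  by rewrite card_sum card_unit card_prod card_ord card_bool muln2.
pose emb (o : I) : option ('I_d * bool) :=
  if o is inr p then Some (widen_ord md p.1, p.2) else None.
have emb_inj : injective emb.
  move=> [[]|[i b]] [[]|[j b']] //= [ij ->].
  by congr (inr (_, _)); exact: val_inj.
pose phi (x : 'I_#|I|) := eigenfun (R := R) (emb (@enum_val I I x)).
rewrite -cardI; apply: (admissible_eigen centered_second_order eps_ge0 (phi := phi)
  (lambda := fun x => eigenval alpha beta (emb (@enum_val I I x)))).
- by rewrite cardI.
- split=> [x|x y]; first exact: (eigenfun_orthonormal d).1.
  by rewrite (eigenfun_orthonormal d).2 (inj_eq emb_inj) (inj_eq enum_val_inj).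
- by move=> x; exact: eigenfunP.
- apply: le_trans le_eps; rewrite -addrA -opprD lerD2l lerN2.
  rewrite (reindex (@enum_rank I))/=; last exact/onW_bij/enum_rank_bij.
  rewrite (eq_bigr (fun o => eigenval alpha beta (emb o))) => [|o _]; last first.
    by congr (eigenval _ _ (emb _)); exact: enum_rankK.
  rewrite big_sumType /= (big_pred1 tt) => [|[]//]; rewrite lerD2l.
  rewrite -(pair_bigA _ (fun (i : 'I_m) (b : bool) => beta i.+1))/= mulr_sumr.
  by apply: ler_sum => i _; rewrite big_bool/= mulr_natl mulr2n.
Qed.

(** Weights at most 2 with total at most n do best, up to C, by saturating the
    first n indices: on the others [beta_j <= C / n]. *)
Lemma sum_weights_le (q : 'I_d -> R) (n : nat) (C : R) :
  (0 < n)%N -> (forall j, (0 < j)%N -> 0 <= beta j) ->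
  (forall j, (0 < j)%N -> j%:R * beta j <= C) ->
  (forall i, 0 <= q i <= 2) -> \sum_i q i <= n%:R ->
  \sum_(i < d) q i * beta i.+1 <= 2 * \sum_(i < d | (i < n)%N) beta i.+1 + C.
Proof.
move=> n0 beta0 betaC q02 qn; rewrite (bigID (fun i : 'I_d => (i < n)%N)) /=.
have nR : 0 < n%:R :> R by rewrite ltr0n.
have C0 : 0 <= C by apply: le_trans (betaC 1%N isT); rewrite mul1r beta0.
apply: lerD.
  rewrite mulr_sumr; apply: ler_sum => i _.
  by rewrite ler_wpM2r ?beta0//; have /andP[] := q02 i.
apply: (@le_trans _ _ (\sum_(i < d | ~~ (i < n)%N) q i * (C / n%:R))).
  apply: ler_sum => i; rewrite -leqNgt => ni.
  have /andP[q0 _] := q02 i; rewrite ler_wpM2l// ler_pdivlMr// mulrC.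
  apply: le_trans (betaC i.+1 isT); rewrite ler_wpM2r ?beta0// ler_nat.
  exact: leq_trans ni (leqnSn _).
rewrite -mulr_suml mulrA ler_pdivrMr// mulrC ler_wpM2l//.
apply: le_trans qn; rewrite [leRHS](bigID (fun i : 'I_d => (i < n)%N)) /= lerDr.
by apply: sumr_ge0 => i _; have /andP[] := q02 i.
Qed.

(** The weight of a coordinate in [sum_weights_le] is the sum of the two
    diagonal entries of the projector that belong to its cosine and its sine.
    The constant function is left out: one functional is enough to capture it,
    so it adds nothing to a lower bound. *)
Lemma admissible_lower_bound n (C : R) : (n <= d)%N -> 
  (forall j, (0 < j)%N -> 0 <= beta j) ->
  (forall j, (0 < j)%N -> j%:R * beta j <= C) ->
  admissible P B eps n ->
  2 * \sum_(i < d) beta i.+1 - 2 * \sum_(i < n) beta i.+1 - C <= eps ^+ 2 * kappa.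
Proof.
move=> nd beta0 betaC adm; have n0 := adm.1.
apply: (admissible_lower centered_second_order eps_ge0 adm) => psi psiL.
pose I : finType := ('I_d * bool)%type.
pose phi (x : 'I_#|I|) := wave (R := R) (@enum_val I I x).
have [||p [p01 pn]] := @mean_sq_error_ge _ _ _ _ _ _ _ _ _ _ _ centered_second_order
    _ _ psi phi (fun x => beta (@enum_val I I x).1.+1) psiL.
- split=> [x|x y]; first exact: wave_L2.
  by rewrite dot_wave (inj_eq enum_val_inj).
- by move=> x; exact: eigen_wave.
apply: le_trans; rewrite lee_fin.
have reidx (F : 'I_#|I| -> R) : \sum_x F x =
    \sum_(i < d) (F (enum_rank (i, true)) + F (enum_rank (i, false))).
  rewrite (reindex (@enum_rank I))/=; last exact/onW_bij/enum_rank_bij.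
  transitivity (\sum_(x : I) F (enum_rank (x.1, x.2))).
    by apply: eq_bigr => -[].
  rewrite -(pair_bigA _ (fun i b => F (@enum_rank I (i, b))))/=.
  by apply: eq_bigr => i _; rewrite big_bool.
rewrite reidx; pose q i := p (enum_rank (i, true)) + p (enum_rank (i, false)).
rewrite [leRHS](eq_bigr (fun i : 'I_d => 2 * beta i.+1 - q i * beta i.+1)); last first.
  by move=> i _; rewrite !enum_rankK /q /=; ring.
rewrite sumrB -mulr_sumr -addrA -opprD lerD2l lerN2.
rewrite (big_ord_widen d (fun i => beta i.+1))//.
apply: sum_weights_le => //; last by rewrite -reidx.
move=> i; have /andP[a0 a1] := p01 (enum_rank (i, true)).
have /andP[b0 b1] := p01 (enum_rank (i, false)).
by rewrite /q addr_ge0//= -[2]/(1 + 1) lerD.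
Qed.

End KorobovComplexity.

(** * Logarithmic growth of partial sums *)

Section LogarithmicSums.
Context {R : realType}.

Definition harm (m : nat) : R := \sum_(i < m) i.+1%:R^-1.

Lemma ln_succ_le (j : nat) : (0 < j)%N -> ln j.+1%:R - ln j%:R <= j%:R^-1 :> R.
Proof.
move=> j0; have jR : 0 < j%:R :> R by rewrite ltr0n.
rewrite -ln_div ?posrE ?ltr0n// -natr1 mulrDl mulfV ?gt_eqF// mul1r.
by apply: le_ln1Dx; rewrite (lt_trans _ (_ : 0 < _)) ?invr_gt0// oppr_lt0.
Qed.

Lemma ln_succ_ge (j : nat) : (0 < j)%N -> j.+1%:R^-1 <= ln j.+1%:R - ln j%:R :> R.
Proof.
move=> j0; have jR : 0 < j%:R :> R by rewrite ltr0n.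
have j1R : 0 < j.+1%:R :> R by rewrite ltr0n.
rewrite -[leRHS]opprB -ln_div ?posrE// lerNr.
rewrite (_ : j%:R / j.+1%:R = 1 + - j.+1%:R^-1); last first.
  by rewrite -natr1; field; rewrite natr1 gt_eqF.
by apply: le_ln1Dx; rewrite ltrN2 invf_lt1// ltr1n.
Qed.

Lemma harm_le m : harm m.+1 <= 1 + ln m.+1%:R.
Proof.
elim: m => [|m IH]; first by rewrite /harm big_ord1 invr1 ln1 addr0.
rewrite /harm big_ord_recr/=; apply: le_trans (lerD IH (ln_succ_ge (ltn0Sn m))) _.
by lra.
Qed.

Lemma harm_ge m : ln m.+1%:R <= harm m.
Proof.
elim: m => [|m IH]; first by rewrite /harm big_ord0 ln1.
rewrite /harm big_ord_recr/=; apply: le_trans (lerD IH (ln_succ_le (ltn0Sn m))).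
by lra.
Qed.

Lemma harm_ln m : (0 < m)%N -> `|harm m - ln m%:R| <= 1.
Proof.
case: m => // m _; rewrite ler_norml; apply/andP; split.
  have := harm_ge m.+1.
  have : ln m.+1%:R <= ln m.+2%:R :> R by rewrite ler_ln ?posrE ?ltr0n// ler_nat.
  lra.
have := harm_le m; lra.
Qed.

(** [f m = k ln m + o(ln m)], in a form that holds for all m, so that it can be
    used at two arguments at once and when m does not tend to infinity. *)
Definition log_asymptotic (f : nat -> R) (k : R) :=
  forall delta : R, 0 < delta -> exists C : R,
    forall m, (0 < m)%N -> `|f m - k * ln m%:R| <= C + delta * ln m%:R.

(** Beyond some J the terms differ from [k / i] by at most [delta / i], and the
    harmonic sums are within 1 of the logarithm. *)
Lemma log_asymptotic_sum (a : nat -> R) (k : R) :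
  j%:R * a j @[j --> \oo] --> k ->
  log_asymptotic (fun m => \sum_(i < m) a i.+1) k.
Proof.
move=> ak delta delta0.
have [J _ HJ] : \forall j \near \oo, `|k - j%:R * a j| <= delta.
  by have /cvgrPdist_le := ak; apply.
pose e i := a i.+1 - k / i.+1%:R.
pose C0 := \sum_(i < J) `|e i|.
exists (C0 + delta + `|k|) => m m0.
have eJ i : `|e (J + i)%N| <= delta / i.+1%:R.
  have j0 : 0 < (J + i).+1%:R :> R by rewrite ltr0n.
  have -> : e (J + i)%N = - (k - (J + i).+1%:R * a (J + i).+1) / (J + i).+1%:R.
    by rewrite /e; field; rewrite gt_eqF.
  rewrite normrM normrN normfV (gtr0_norm j0) ler_pM ?invr_ge0 ?(ltW j0)//.
    by apply: (HJ (J + i).+1%N); rewrite /=; lia.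
  by rewrite lef_pV2 ?posrE ?ltr0n// ler_nat; lia.
have sum_e : `|\sum_(i < m) e i| <= C0 + delta * harm m.
  apply: le_trans (ler_norm_sum _ _ _) _.
  (* J extra terms are added so that the sum splits at J whatever m is *)
  apply: (@le_trans _ _ (\sum_(i < J + m) `|e i|)).
    by rewrite addnC big_split_ord /= lerDl sumr_ge0.
  rewrite big_split_ord /= lerD2l /harm mulr_sumr; apply: ler_sum => i _.
  exact: eJ.
have -> : \sum_(i < m) a i.+1 - k * ln m%:R =
    \sum_(i < m) e i + k * (harm m - ln m%:R).
  rewrite /e sumrB -mulr_sumr /harm; ring.
apply: le_trans (ler_normD _ _) _; rewrite normrM.
have := harm_ln m0 => hl.
have kh : `|k| * `|harm m - ln m%:R| <= `|k| by rewrite ler_piMr.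
have dh : delta * harm m <= delta + delta * ln m%:R.
  rewrite -[X in X + _]mulr1 -mulrDr ler_wpM2l ?(ltW delta0)//.
  by move: hl; rewrite ler_norml => /andP[_]; lra.
lra.
Qed.

End LogarithmicSums.

(** * From error bounds to the logarithm of the complexity *)

Section LogComplexity.
Context {R : realType}.
(** SA, SB and SK stand for the partial sums of alpha, of beta and of the
    diagonal values of the kernel, [adm d n] for the admissibility of n
    functionals in dimension d, N for the complexity and e2 for [eps^2]. *)
Variables (SA SB SK : nat -> R) (c r e2 C1 theta : R).
Variables (adm : nat -> nat -> Prop) (N : nat -> nat).
Hypotheses (c_gt0 : 0 < c) (r_ge0 : 0 <= r) (e2_01 : 0 <= e2 <= 1).
Hypotheses (thetaE : theta = 1 - e2 * (1 + r / 2)) (theta_gt0 : 0 < theta)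
  (theta_lt1 : theta < 1).
Hypotheses (SAln : log_asymptotic SA (r * c)) (SBln : log_asymptotic SB c)
  (SKln : log_asymptotic SK ((r + 2) * c)).
Hypothesis adm_gt0 : forall d n, adm d n -> (0 < n)%N.
Hypothesis adm_min : forall d n, adm d n -> adm d (N d) /\ (N d <= n)%N.
Hypothesis adm_trunc : forall d m, (0 < d)%N -> (m <= d)%N ->
  SK d - SA d - 2 * SB m <= e2 * SK d -> adm d m.*2.+1.
Hypothesis adm_low : forall d n, (0 < d)%N -> (n <= d)%N -> adm d n ->
  2 * SB d - 2 * SB n - C1 <= e2 * SK d.

Lemma near_ln_ge (M : R) : \forall d \near \oo, M <= ln d%:R :> R.
Proof.
exists (Num.truncn (expR M)).+1 => // d /= dM.
have ed : expR M <= d%:R.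
  by rewrite ltW// (lt_le_trans (truncnS_gt _))// ler_nat.
by rewrite -[leLHS]expRK ler_ln ?posrE ?expR_gt0// (lt_le_trans _ ed) ?expR_gt0.
Qed.

(** Truncation at m close to [d^(theta + delta0)] is admissible for large d: its
    squared error falls short of the admissible one by [2 c delta0 ln d].  Half of
    this absorbs the terms in [ln d] of the three asymptotics, each taken with
    precision [c delta0 / 4], and the other half absorbs their constants. *)
Lemma log_complexity_upper (delta0 : R) : 0 < delta0 -> theta + delta0 <= 1 ->
  \forall d \near \oo, adm d (N d) /\
    ln (N d)%:R <= (theta + 2 * delta0) * ln d%:R.
Proof.
move=> delta00 x1; set x := theta + delta0.
have x0 : 0 < x by rewrite /x addr_gt0.
have /andP[e20 e21] := e2_01; have th0 := theta_gt0; have th1 := theta_lt1.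
have cp := c_gt0; have rp := r_ge0.
pose delta := c * delta0 / 4.
have delta_gt0 : 0 < delta by rewrite /delta divr_gt0 ?mulr_gt0.
have delta_lec : delta <= c.
  rewrite /delta -mulrA ler_piMr ?(ltW c_gt0)//; lra.
have [CA HA] := SAln delta_gt0; have [CB HB] := SBln delta_gt0.
have [CK HK] := SKln delta_gt0.
pose M := 1 + ln 3 / delta0 + (`|CK| + `|CA| + 2 * `|CB| + 2 * c * ln 2) / (c * delta0).
near=> d; have : M <= ln d%:R by near: d; exact: near_ln_ge.
set L := ln d%:R : R => ML.
have ln20 : 0 <= ln 2 :> R by rewrite ln_ge0// ler1n.
have ln30 : 0 <= ln 3 :> R by rewrite ln_ge0// ler1n.
have cd0 : 0 < c * delta0 by rewrite mulr_gt0.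
have L1 : 1 <= L.
  apply: le_trans ML; rewrite /M -addrA lerDl addr_ge0 ?divr_ge0 ?(ltW delta00) ?(ltW cd0)//.
  by rewrite !addr_ge0 ?mulr_ge0 ?(ltW c_gt0).
have L_ge0 : 0 <= L := le_trans ler01 L1.
have d0 : (0 < d)%N.
  rewrite lt0n; apply/eqP => dE; move: L1.
  by rewrite /L [X in ln X%:R]dE ln0// ler10.
have dR : 0 < d%:R :> R by rewrite ltr0n.
pose y : R := d%:R `^ x.
have lny : ln y = x * L by rewrite /y ln_powR.
have y0 : 0 < y by exact: powR_gt0.
have y1 : 1 <= y.
  by rewrite -ler_ln ?posrE// ln1 lny mulr_ge0 ?(ltW x0)//; lra.
have [m my ym] : exists2 m : nat, m%:R <= y & y < m.+1%:R.
  by exists (Num.truncn y); [rewrite truncn_le// ltW|exact: truncnS_gt].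
have m0 : (0 < m)%N.
  by rewrite lt0n; apply/eqP => mE; move: ym; rewrite mE ltNge y1.
have md : (m <= d)%N.
  rewrite -(ler_nat R); apply: le_trans my _.
  by rewrite -[leRHS]powRr1 ?ler0n// ler_powR// ler1n.
have lnm : x * L - ln 2 <= ln m%:R.
  rewrite lerBlDr -lny -lnM ?posrE ?ltr0n// ler_ln ?posrE ?mulr_gt0 ?ltr0n//.
  apply: le_trans (ltW ym) _; rewrite -[leRHS]natrM ler_nat.
  by rewrite muln2 -addnn -addn1 leq_add2l.
have lnmL : ln m%:R <= L by rewrite ler_ln ?posrE ?ltr0n// ler_nat.
have adm_m : adm d m.*2.+1.
  apply: adm_trunc => //.
  have := HA d d0; have := HB m m0; have := HK d d0.
  rewrite !ler_norml -/L => /andP[_ hK] /andP[hB _] /andP[hA _].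
  have hK' : (1 - e2) * SK d <= (1 - e2) * ((r + 2) * c * L + CK + delta * L).
    by apply: ler_wpM2l; lra.
  have CK_le : (1 - e2) * CK <= `|CK|.
    by apply: le_trans (ler_norm _) _; rewrite normrM ler_piMl// ger0_norm ?subr_ge0// gerBl.
  have dL0 : 0 <= e2 * (delta * L).
    by apply: mulr_ge0 => //; apply: mulr_ge0 => //; exact: ltW.
  have clm : c * (x * L - ln 2) <= c * ln m%:R by rewrite ler_wpM2l// ltW.
  have dlm : delta * ln m%:R <= delta * L by rewrite ler_wpM2l// ltW.
  have ctheta : c * theta * L = c * L - e2 * (1 + r / 2) * c * L.
    by rewrite thetaE; ring.
  have cx : c * (x * L - ln 2) = c * theta * L + c * delta0 * L - c * ln 2.
    by rewrite /x; ring.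
  have dL : delta * L = c * delta0 * L / 4 by rewrite /delta; ring.
  have big_L : `|CK| + `|CA| + 2 * `|CB| + 2 * c * ln 2 <= c * delta0 * L.
    rewrite -ler_pdivrMl// mulrC; apply: le_trans ML.
    by rewrite /M lerDr addr_ge0// divr_ge0// ltW.
  have := ler_norm CA; have := ler_norm CB.
  lra.
have [adm_N Nm] := adm_min adm_m; split=> //.
have N0 := adm_gt0 adm_N.
have N3y : (N d)%:R <= 3 * y.
  apply: (@le_trans _ _ (3 * m%:R)); last by rewrite ler_wpM2l.
  rewrite -[leRHS]natrM ler_nat; apply: leq_trans Nm _.
  by rewrite mulSn mul2n -add1n leq_add2r.
apply: (@le_trans _ _ (ln 3 + x * L)).
  by rewrite -lny -lnM ?posrE// ler_ln ?posrE ?mulr_gt0 ?ltr0n.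
have : ln 3 <= delta0 * L.
  rewrite -ler_pdivrMl// mulrC; apply: le_trans ML.
  rewrite /M -addrA addrCA lerDl addr_ge0// divr_ge0 ?(ltW cd0)//.
  by rewrite !addr_ge0 ?mulr_ge0 ?(ltW c_gt0).
rewrite /x; lra.
Unshelve. all: by end_near.
Qed.

(** If [N d] exceeds d there is nothing to prove, as [theta < 1].  Otherwise the
    lower bound on the error gives [2 c ln (N d) >= 2 c theta ln d] up to error
    terms, which are bounded by [2 c delta0 ln d] thanks to
    [ln (N d) <= ln d] and the precision [c delta0 / 5]. *)
Lemma log_complexity_lower (delta0 : R) : 0 < delta0 -> 
  \forall d \near \oo, adm d (N d) ->
    (theta - delta0) * ln d%:R <= ln (N d)%:R.
Proof.
move=> delta00.
have /andP[e20 e21] := e2_01; have th0 := theta_gt0; have th1 := theta_lt1.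
have cp := c_gt0; have rp := r_ge0.
pose delta := c * delta0 / 5.
have delta_gt0 : 0 < delta by rewrite /delta divr_gt0 ?mulr_gt0.
have [CB HB] := SBln delta_gt0; have [CK HK] := SKln delta_gt0.
pose M := 1 + (4 * `|CB| + `|C1| + `|CK|) / (c * delta0).
near=> d; have : M <= ln d%:R by near: d; exact: near_ln_ge.
set L := ln d%:R : R => ML adm_N.
have cd0 : 0 < c * delta0 by rewrite mulr_gt0.
have L1 : 1 <= L.
  by apply: le_trans ML; rewrite /M lerDl divr_ge0 ?(ltW cd0)// !addr_ge0.
have L_ge0 : 0 <= L := le_trans ler01 L1.
have d0 : (0 < d)%N.
  rewrite lt0n; apply/eqP => dE; move: L1.
  by rewrite /L [X in ln X%:R]dE ln0// ler10.
have N0 := adm_gt0 adm_N.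
have [Nd|dN] := leqP (N d) d; last first.
  apply: (@le_trans _ _ L); first by rewrite ler_piMl; lra.
  by rewrite ler_ln ?posrE ?ltr0n// ler_nat ltnW.
set l := ln (N d)%:R : R.
have lL : l <= L by rewrite ler_ln ?posrE ?ltr0n// ler_nat.
have := adm_low d0 Nd adm_N.
have := HB _ d0; have := HB _ N0; have := HK _ d0.
rewrite !ler_norml -/L -/l => /andP[_ hK] /andP[_ hBN] /andP[hBd _] low.
have hK' : e2 * SK d <= e2 * ((r + 2) * c * L + CK + delta * L).
  by apply: ler_wpM2l => //; lra.
have CK_le : e2 * CK <= `|CK|.
  by apply: le_trans (ler_norm _) _; rewrite normrM ler_piMl// ger0_norm.
have edL : e2 * (delta * L) <= delta * L.
  by rewrite ler_piMl// mulr_ge0//; exact: ltW.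
have dl : delta * l <= delta * L by rewrite ler_wpM2l// ltW.
have ctheta : c * theta * L = c * L - e2 * (1 + r / 2) * c * L.
  by rewrite thetaE; ring.
have dL : delta * L = c * delta0 * L / 5 by rewrite /delta; ring.
have big_L : 4 * `|CB| + `|C1| + `|CK| <= c * delta0 * L.
  rewrite -ler_pdivrMl// mulrC; apply: le_trans ML.
  by rewrite /M lerDr.
have := ler_norm CB; have := ler_norm C1 => hC1 hCB.
rewrite -(ler_pM2l c_gt0).
lra.
Unshelve. all: by end_near.
Qed.

End LogComplexity.

(** * Asymptotics of the parameters *)

Section DiagonalAsymptotics.
Context {R : realType}.
Variables (alpha beta sigma : nat -> R) (c r : R).

(** This is the zeta function at s, left in the form in which it occurs on the
    diagonal of the kernel. *)
Definition zeta_diag (s : R) : R :=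
  limn (fun n => \sum_(1 <= k < n) k%:R `^ (- s) * cos (2 * pi * k%:R * (0 - 0))).

(** The first term of the series is 1, and its tail is controlled by
    [sum_powRN_le]. *)
Lemma zeta_diag_bounds (s : R) : 1 < s -> 1 <= zeta_diag s <= 1 + (s - 1)^-1.
Proof.
move=> s1; pose w k := k%:R `^ (- s) * cos (2 * pi * k%:R * (0 - 0)) : R.
have wE k : w k = k%:R `^ (- s) by rewrite /w subrr mulr0 cos0 mulr1.
have cw : cvgn (fun n => \sum_(1 <= k < n) w k).
  by apply: cvg_korobov => // k; exact: cos_max.
apply/andP; split.
  apply: limr_ge => //; exists 2%N => // n /= n2.
  rewrite big_ltn// -/(w _) wE powR1 lerDl.
  by apply: sumr_ge0 => k _; rewrite -/(w _) wE powR_ge0.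
apply: limr_le => //; apply: nearW => n.
apply: le_trans (sum_powRN_abs n s1 (fun k => cos_max (2 * pi * k%:R * (0 - 0)))).
by apply: ler_sum => k _; exact: ler_norm.
Qed.

Lemma cvg_zeta_diag : sigma j @[j --> \oo] --> +oo ->
  zeta_diag (sigma j) @[j --> \oo] --> (1 : R).
Proof.
move=> sigma_oo; apply/cvgrPdist_le => e e0.
have sig : \forall j \near \oo, 1 + e^-1 <= sigma j.
  by move/cvgryPge : sigma_oo; apply.
near=> j.
have sj : 1 + e^-1 <= sigma j by near: j.
have einv : 0 < e^-1 by rewrite invr_gt0.
have s1 : 1 < sigma j by rewrite (lt_le_trans _ sj)// ltrDl.
have /andP[z1 z2] := zeta_diag_bounds s1.
rewrite distrC ger0_norm ?subr_ge0// lerBlDl; apply: le_trans z2 _.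
by rewrite lerD2l invf_ple ?posrE ?subr_gt0// lerBrDl.
Unshelve. all: by end_near. Qed.

Hypothesis c_gt0 : 0 < c.
Hypothesis beta_gt0 : forall j, (0 < j)%N -> 0 < beta j.
Hypothesis beta_equiv : beta j / (c * j%:R^-1) @[j --> \oo] --> (1 : R).
Hypothesis ratio_cvg : alpha j / beta j @[j --> \oo] --> r.
Hypothesis sigma_cvg : sigma j @[j --> \oo] --> +oo.

Lemma cvg_jbeta : j%:R * beta j @[j --> \oo] --> c.
Proof.
rewrite -[X in _ --> X]mulr1.
apply: cvg_trans (cvgM (cvg_cst c) beta_equiv); apply: near_eq_cvg.
exists 1%N => // j /= j1.
by rewrite invfM invrK mulrCA mulVKf ?gt_eqF// mulrC.
Qed.

Lemma cvg_jalpha : j%:R * alpha j @[j --> \oo] --> r * c.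
Proof.
apply: cvg_trans (cvgM ratio_cvg cvg_jbeta); apply: near_eq_cvg.
exists 1%N => // j /= j1.
by field; rewrite gt_eqF// beta_gt0.
Qed.

Lemma cvg_jdiag : j%:R * korobov_diag alpha beta sigma j @[j --> \oo] --> (r + 2) * c.
Proof.
have -> : (fun j => j%:R * korobov_diag alpha beta sigma j) =
    (fun j => j%:R * alpha j + 2 * (j%:R * beta j) * zeta_diag (sigma j)).
  by apply/funext => j; rewrite /korobov_diag /korobov -/(zeta_diag _); ring.
rewrite mulrDl -[2 * c]mulr1.
apply: cvgD; first exact: cvg_jalpha.
apply: cvgM; last exact: cvg_zeta_diag.
by apply: cvgM; [exact: cvg_cst|exact: cvg_jbeta].
Qed.

Lemma jbeta_bounded : exists C, forall j, (0 < j)%N -> j%:R * beta j <= C.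
Proof.
have [M [_ HM]] := cvg_seq_bounded (cvgP _ cvg_jbeta).
exists (`|M| + 1) => j _.
have MM : M < `|M| + 1 by rewrite (le_lt_trans (ler_norm M))// ltrDl.
apply: le_trans (ler_norm _) _; exact: (HM _ MM j I).
Qed.

End DiagonalAsymptotics.

(** * The complexity of additive Korobov fields *)

Theorem theorem5 (R : realType) (alpha beta sigma : nat -> R) (c r : R)
    (dO : nat -> measure_display)
    (Omega : forall d : nat, measurableType (dO d))
    (P : forall d : nat, probability (Omega d) R)
    (B : forall d : nat, Omega d -> d.-tuple R -> R)
    (alpha_gt0 : forall j : nat, (0 < j)%N -> 0 < alpha j)
    (beta_gt0 : forall j : nat, (0 < j)%N -> 0 < beta j)
    (sigma_gt1 : forall j : nat, (0 < j)%N -> 1 < sigma j)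
    (B_field : forall d : nat, (0 < d)%N ->
       centered_field (P d) (additive_korobov alpha beta sigma (d := d)) (B d))
    (c_gt0 : 0 < c) (r_ge0 : 0 <= r)
    (beta_equiv : beta j / (c * j%:R^-1) @[j --> \oo] --> (1 : R))
    (ratio_cvg : alpha j / beta j @[j --> \oo] --> r)
    (sigma_cvg : sigma j @[j --> \oo] --> +oo) :
  let eps0 := (1 + r / 2) `^ (- 2^-1) in
  forall eps : R, 0 < eps < eps0 ->
  (fun d : nat => ln (complexity (P d) (B d) eps)%:R : R) =
  (fun d : nat => (1 - (eps / eps0) ^+ 2) * ln d%:R)
    +o_\oo (fun d : nat => ln d%:R : R).
Proof.
move=> eps0 eps /andP[eps_gt0 eps_lt].
have r1 : 1 <= 1 + r / 2 by rewrite lerDl divr_ge0.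
have rp : 0 < 1 + r / 2 by rewrite (lt_le_trans ltr01).
have eps0_gt0 : 0 < eps0 by exact: powR_gt0.
have eps0_sq : eps0 ^+ 2 = (1 + r / 2)^-1.
  rewrite /eps0 -powR_mulrn ?powR_ge0// -powRrM mulNr mulVf// powRN powRr1//.
  exact: ltW.
pose theta := 1 - (eps / eps0) ^+ 2.
have thetaE : theta = 1 - eps ^+ 2 * (1 + r / 2).
  by rewrite /theta exprMn exprVn eps0_sq invrK.
have ratio01 : 0 < eps / eps0 < 1.
  by rewrite divr_gt0// ltr_pdivrMr// mul1r.
have /andP[q0 q1] := ratio01.
have theta_gt0 : 0 < theta by rewrite subr_gt0 expr_lt1// ltW.
have theta_lt1 : theta < 1 by rewrite /theta gtrBl exprn_gt0.
have e2_01 : 0 <= eps ^+ 2 <= 1.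
  rewrite sqr_ge0/=; have : eps ^+ 2 <= eps ^+ 2 * (1 + r / 2).
    by rewrite ler_peMr ?sqr_ge0.
  by move: theta_gt0; rewrite thetaE; lra.
have [C1 HC1] := jbeta_bounded c_gt0 beta_equiv.
have SAln := log_asymptotic_sum (cvg_jalpha c_gt0 beta_gt0 beta_equiv ratio_cvg).
have SBln := log_asymptotic_sum (cvg_jbeta c_gt0 beta_equiv).
have SKln := log_asymptotic_sum
  (cvg_jdiag c_gt0 beta_gt0 beta_equiv ratio_cvg sigma_cvg).
pose adm d n := (0 < d)%N /\ admissible (P d) (B d) eps n.
pose N d := complexity (P d) (B d) eps.
have adm_gt0 d n : adm d n -> (0 < n)%N by case=> _ [].
have adm_min d n : adm d n -> adm d (N d) /\ (N d <= n)%N.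
  by move=> [d0 admn]; have [? ?] := complexityP admn; split.
have eps_ge0 := ltW eps_gt0.
have adm_trunc d m (d0 : (0 < d)%N) (md : (m <= d)%N) le_eps : adm d m.*2.+1 :=
  conj d0 (admissible_truncation sigma_gt1 (B_field d d0) eps_ge0 md le_eps).
have adm_low d n (d0 : (0 < d)%N) (nd : (n <= d)%N) (a : adm d n) :=
  admissible_lower_bound sigma_gt1 (B_field d d0) eps_ge0 nd
    (fun j j0 => ltW (beta_gt0 j j0)) HC1 a.2.
suff key (e : R) : 0 < e -> \forall d \near \oo, (0 < d)%N /\
    `|ln (N d)%:R - theta * ln d%:R| <= e * ln d%:R.
  apply/eqaddoP => e e0; apply: filterS (key e e0) => d [d0].
  by rewrite [`|ln d%:R|]ger0_norm// ln_ge0// ler1n.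
move=> e0; pose delta0 := Num.min (e / 2) (1 - theta).
have delta0_gt0 : 0 < delta0 by rewrite lt_min divr_gt0//= subr_gt0.
have delta0_e : 2 * delta0 <= e by rewrite mulrC -ler_pdivlMr// ge_min lexx.
have delta0_theta : theta + delta0 <= 1 by rewrite -lerBrDl ge_min lexx orbT.
have up := log_complexity_upper c_gt0 r_ge0 e2_01 thetaE theta_gt0 theta_lt1 SAln SBln SKln
  adm_gt0 adm_min adm_trunc delta0_gt0 delta0_theta.
have low := log_complexity_lower N c_gt0 r_ge0 e2_01 thetaE theta_gt0 theta_lt1 SBln SKln
  adm_gt0 adm_low delta0_gt0.
apply: filterS2 up low => d [admN Nup] /(_ admN) Nlow; split; first exact: admN.1.
have L0 : 0 <= ln d%:R :> R by apply: ln_ge0; rewrite ler1n; exact: admN.1.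
have eL : 2 * delta0 * ln d%:R <= e * ln d%:R by rewrite ler_wpM2r.
have dL : 0 <= delta0 * ln d%:R by rewrite mulr_ge0// ltW.
rewrite ler_norml; apply/andP; split.
- by rewrite lerNl opprB; apply: le_trans eL; move: Nlow; rewrite mulrBl; lra.
- by rewrite lerBlDl -mulrDl; apply: le_trans Nup _; rewrite ler_wpM2r// lerD2l.
Qed.
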